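(* Every identity of degree less than or equal to $6$ satisfied by the dicommutator in every alternative dialgebra is a consequence of right anticommutativity $a(bc)+a(cb)\equiv 0$ and the di-Malcev identity $$((ab)c)d - ((ad)b)c - (a(cd))b - (ac)(bd) - a((bc)d) \equiv 0 .$$ In particular, there are no special identities for Malcev dialgebras in degrees $5$ or $6$, and any special identity for Malcev dialgebras must have degree at least $7$.
   Context: A dialgebra is a vector space $D$ with two bilinear operations $\dashv,\vdash\colon D\times D\to D$. A 0-dialgebra is a dialgebra satisfying the left and right bar identities $(a\dashv b)\vdash c \equiv (a\vdash b)\vdash c$ and $a\dashv(b\dashv c)\equiv a\dashv(b\vdash c)$. In a dialgebra define $(a,b,c)_\dashv = (a\dashv b)\dashv c - a\dashv(b\dashv c)$, $(a,b,c)_\vdash = (a\vdash b)\vdash c - a\vdash(b\vdash c)$, $(a,b,c)_\times = (a\vdash b)\dashv c - a\vdash(b\dashv c)$. An alternative dialgebra is a 0-dialgebra satisfying $(a,b,c)_\dashv+(c,b,a)_\vdash\equiv 0$, $(a,b,c)_\dashv-(b,c,a)_\vdash\equiv 0$, $(a,b,c)_\times+(a,c,b)_\vdash\equiv 0$. The dicommutator in a dialgebra is the bilinear operation $\langle a,b\rangle = a\dashv b - b\vdash a$. A polynomial identity for one bilinear operation is an element of a free nonassociative algebra; it is satisfied by the dicommutator in $D$ if it vanishes for all values of the variables in $D$ when every product $xy$ is interpreted as $\langle x,y\rangle$. An identity is a consequence of a set of identities if it lies in the ideal, closed under all endomorphisms, which they generate in the free nonassociative algebra. Over a field of characteristic not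 $2$, a (right) Malcev dialgebra is a vector space with a bilinear operation $ab$ satisfying right anticommutativity and the di-Malcev identity. A special identity for Malcev dialgebras is a polynomial identity which is satisfied by the dicommutator in every alternative dialgebra, but which is not a consequence of right anticommutativity and the di-Malcev identity.
   Formalization: The ground field is assumed to have characteristic neither 2 nor 3; in characteristic 3 the claim fails, since the dicommutator then satisfies the degree 3 Leibniz identity, which is not a consequence of right anticommutativity and the di-Malcev identity. *)

(* Defs.v *)
From HB Require Import structures.
From mathcomp Require Import all_boot all_algebra.
From mathcomp Require Import finmap.
From mathcomp.multinomials Require Import monalg.

Set Implicit Arguments.
Unset Strict Implicit.
Unset Printing Implicit Defensive.

Import GRing.Theory.
Local Open Scope ring_scope.

(* The free magma on x_0, x_1, x_2, ...; it has no empty word, so the free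
   nonassociative algebra below has no unit. *)
Inductive magma : Type :=
| MVar of nat
| MMul of magma & magma.

Fixpoint magma_code (u : magma) : GenTree.tree nat :=
  match u with
  | MVar i => GenTree.Leaf i
  | MMul v w => GenTree.Node 0 [:: magma_code v; magma_code w]
  end.

Fixpoint magma_decode (t : GenTree.tree nat) : option magma :=
  match t with
  | GenTree.Leaf i => Some (MVar i)
  | GenTree.Node _ [:: t1; t2] =>
      if (magma_decode t1, magma_decode t2) is (Some v, Some w)
      then Some (MMul v w) else None
  | _ => None
  end.

Lemma magma_codeK : pcancel magma_code magma_decode.
Proof. by elim=> //= v -> w ->. Qed.

HB.instance Definition _ := Countable.copy magma (pcan_type magma_codeK).

Fixpoint magma_size (u : magma) : nat :=
  match u with
  | MVar _ => 1
  | MMul v w => magma_size v + magma_size w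
  end.

Fixpoint magma_eval (T : Type) (op : T -> T -> T) (v : nat -> T) (u : magma) : T :=
  match u with
  | MVar i => v i
  | MMul u1 u2 => op (magma_eval op v u1) (magma_eval op v u2)
  end.

(* The free nonassociative F-algebra on x_0, x_1, x_2, ...; {malg F[magma]}
   only provides its vector space structure, the product is NAmul below. *)
Notation freeNA F := {malg F[magma]}.

Section FreeNonassociativeAlgebra.
Variable F : fieldType.
Local Notation freeNA := (freeNA F).

Definition NAvar (i : nat) : freeNA := << MVar i >>.

Definition NAmul (f g : freeNA) : freeNA :=
  \sum_(u <- msupp f) \sum_(v <- msupp g) (<< f@_u * g@_v *g MMul u v >> : freeNA).

Definition NAdeg (f : freeNA) : nat := \max_(u <- msupp f) magma_size u.

Definition NAeval (D : lmodType F) (op : D -> D -> D) (v : nat -> D)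
    (f : freeNA) : D :=
  \sum_(u <- msupp f) f@_u *: magma_eval op v u.

Definition NAendo (phi : freeNA -> freeNA) : Prop :=
  linear phi /\ {morph phi : f g / NAmul f g}.

Definition Tideal (I : freeNA -> Prop) : Prop :=
  [/\ I 0,
      forall (c : F) f g, I f -> I g -> I (c *: f + g),
      forall f g, I f -> I (NAmul f g) /\ I (NAmul g f)
    & forall phi, NAendo phi -> forall f, I f -> I (phi f)].

(* Membership in the intersection of all T-ideals containing S. *)
Definition consequence (S : freeNA -> Prop) (f : freeNA) : Prop :=
  forall I : freeNA -> Prop,
    Tideal I -> (forall g, S g -> I g) -> I f.

Local Notation "f ** g" := (NAmul f g) (at level 40, left associativity).

Definition right_anticommutativity : freeNA :=
  let a := NAvar 0 in let b := NAvar 1 in let c := NAvar 2 in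
  a ** (b ** c) + a ** (c ** b).

Definition di_Malcev_identity : freeNA :=
  let a := NAvar 0 in let b := NAvar 1 in
  let c := NAvar 2 in let d := NAvar 3 in
  ((a ** b) ** c) ** d - ((a ** d) ** b) ** c - (a ** (c ** d)) ** b
  - (a ** c) ** (b ** d) - a ** ((b ** c) ** d).

Definition Malcev_dialgebra_identities (g : freeNA) : Prop :=
  g = right_anticommutativity \/ g = di_Malcev_identity.

End FreeNonassociativeAlgebra.

Section Dialgebras.
Variables (F : fieldType) (D : lmodType F).

(* Below, [dl a b] is $a \dashv b$ and [dr a b] is $a \vdash b$. *)
Variables dl dr : D -> D -> D.

Definition dialgebra : Prop :=
  bilinear_for *:%R *:%R dl /\ bilinear_for *:%R *:%R dr.

Definition zero_dialgebra : Prop :=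
  [/\ dialgebra,
      forall a b c, dr (dl a b) c = dr (dr a b) c
    & forall a b c, dl a (dl b c) = dl a (dr b c)].

Definition assoc_l (a b c : D) : D := dl (dl a b) c - dl a (dl b c).
Definition assoc_r (a b c : D) : D := dr (dr a b) c - dr a (dr b c).
Definition assoc_x (a b c : D) : D := dl (dr a b) c - dr a (dl b c).

Definition alternative_dialgebra : Prop :=
  [/\ zero_dialgebra,
      forall a b c, assoc_l a b c + assoc_r c b a = 0,
      forall a b c, assoc_l a b c - assoc_r b c a = 0
    & forall a b c, assoc_x a b c + assoc_r a c b = 0].

Definition dicommutator (a b : D) : D := dl a b - dr b a.

End Dialgebras.

Section DicommutatorIdentities.
Variable F : fieldType.

Definition dicommutator_identity (f : freeNA F) : Prop :=
  forall (D : lmodType F) (dl dr : D -> D -> D),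
    alternative_dialgebra dl dr ->
    forall v : nat -> D, NAeval (dicommutator dl dr) v f = 0.

Definition special_identity (f : freeNA F) : Prop :=
  dicommutator_identity f /\
  ~ consequence (@Malcev_dialgebra_identities F) f.

End DicommutatorIdentities.

(* Main.v *)
(** Modulo the two identities, right multiplications satisfy
    R_((bc)d) = R_b R_c R_d - R_d R_b R_c - R_(cd) R_b - R_c R_(bd) = - R_((cb)d),
    so every monomial is a combination of words, that is, its leftmost variable
    acted on by operators R_a and R_(ab).  Over Z[1/6], the relations between the
    two expansions of R_((bc)d) leave 1, 1, 3, 10, 44, 210 multilinear words in
    degrees 1 to 6.

    If E is an alternative algebra, then E + E with (a,m) -| (b,n) = (ab,mb) and
    (a,m) |- (b,n) = (ab,an) is an alternative dialgebra with dicommutator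
    ([a,b],[m,b]); the second summand only receives the leftmost variable.  Taking
    for E the Grassmann envelopes of 7 x 7 strictly triangular matrices, of the
    split octonions and of a 17-dimensional nilpotent superalgebra, one obtains
    functionals which separate the remaining words in any characteristic other
    than 2 and 3.

    Linearization multiplies a monomial by the product of the factorials of the
    multiplicities of the variables to the right of the leftmost one.  In degree
    at most 6 this product divides 24, unless these variables are all equal.  In
    the latter case right anticommutativity kills every monomial which is not
    left-normed, and the coefficient of the left-normed one is detected by a
    dialgebra structure on F[X] + F[X].  *)

Require Import Defs.
From HB Require Import structures.
From Stdlib Require Import ZArith.
From mathcomp Require Import all_boot all_algebra.
From mathcomp Require Import finmap.
From mathcomp.multinomials Require Import monalg.
From mathcomp Require Import ssrZ zify.

Set Implicit Arguments.
Unset Strict Implicit.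
Unset Printing Implicit Defensive.

Import GRing.Theory.
Local Open Scope ring_scope.

(** Finite fields and characteristic 5 shape the argument. Over a small field the homogeneous
    components of an identity cannot be separated by rescaling the variables. Instead, each variable
    is replaced by a sum of letters marked by distinct Grassmann (or commuting, square-zero)
    generators, and the coordinate at the product of all generators is read off. Keeping the
    leftmost variable in a summand of its own removes its multiplicity from the factorials. What
    remains bad is a tail of five equal variables, since 5! vanishes in characteristic 5; hence the
    separate treatment of constant tails. About the elimination only one thing is proved: every row
    it produces still lies in the subspace at hand. That enough relations and functionals were
    supplied is a test on the final tables. The functionals need to be evaluated on the surviving
    words only: commutators in an alternative algebra form a Malcev algebra, so every functional
    respects the relations, which determine its values on the other words. *)

Lemma big_group (T K : eqType) (V : nmodType) (r : seq T) (k : T -> K) (f : T -> V) :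
  \sum_(t <- r) f t = \sum_(l <- undup (map k r)) \sum_(t <- r | k t == l) f t.
Proof.
rewrite (exchange_big_dep xpredT) //= big_seq [RHS]big_seq; apply: eq_bigr => t tr.
rewrite (big_rem (k t)) ?mem_undup ?map_f //= eqxx big_seq_cond big1 ?addr0 // => l.
by case/andP=> lr /eqP E; move: lr; rewrite -E mem_rem_uniqF ?undup_uniq.
Qed.

(** * Integral elimination with pivots of the form 2^a 3^b *)

Section Subspace.
Variables (F : fieldType) (V : lmodType F).

Definition subspace (I : V -> Prop) : Prop :=
  I 0 /\ forall (c : F) u v, I u -> I v -> I (c *: u + v).

Lemma subspace_eq0 : subspace (fun v => v = 0).
Proof. by split=> // c u v -> ->; rewrite scaler0 addr0. Qed.

Variable I : V -> Prop.
Hypothesis subI : subspace I.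

Lemma sub0 : I 0. Proof. by case: subI. Qed.

Lemma subZ c u : I u -> I (c *: u).
Proof. by case: subI => I0 IL Iu; rewrite -[_ *: _]addr0; apply: IL. Qed.

Lemma subD u v : I u -> I v -> I (u + v).
Proof. by case: subI => I0 IL Iu Iv; rewrite -[u]scale1r; apply: IL. Qed.

Lemma subN u : I u -> I (- u).
Proof. by move=> Iu; rewrite -scaleN1r; apply: subZ. Qed.

Lemma subB u v : I u -> I v -> I (u - v).
Proof. by move=> Iu Iv; apply/subD/subN. Qed.

Lemma sub_sum (T : eqType) (r : seq T) (P : pred T) (f : T -> V) :
  (forall t, t \in r -> P t -> I (f t)) -> I (\sum_(t <- r | P t) f t).
Proof.
elim: r => [|t r IH] If; first by rewrite big_nil; apply: sub0.
have IHr : I (\sum_(t <- r | P t) f t).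
  by apply: IH => s sr; apply: If; rewrite inE sr orbT.
by rewrite big_cons; case: ifP => // Pt; apply: subD => //; apply: If; rewrite ?inE ?eqxx.
Qed.

Lemma cong_refl u : I (u - u). Proof. by rewrite subrr; apply: sub0. Qed.

Lemma cong_trans u v w : I (u - v) -> I (v - w) -> I (u - w).
Proof. by move=> uv vw; rewrite -(subrKA v); apply: subD. Qed.

Lemma cong_sub u v : I (u - v) -> I v -> I u.
Proof. by move=> uv Iv; rewrite -(subrK v u); apply: subD. Qed.

Lemma cong_sym u v : I (u - v) -> I (v - u).
Proof. by move=> uv; rewrite -opprB; apply: subN. Qed.

Lemma congD u v u' v' : I (u - v) -> I (u' - v') -> I ((u + u') - (v + v')).
Proof. by move=> uv uv'; rewrite opprD addrACA; apply: subD. Qed.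

Lemma congN u v : I (u - v) -> I (- u - - v).
Proof. by move=> uv; rewrite -opprD; apply: subN. Qed.
End Subspace.

Lemma positive_eqP : Equality.axiom Pos.eqb.
Proof. by move=> k l; apply: (iffP idP) => /Pos.eqb_eq. Qed.

HB.instance Definition _ := hasDecEq.Build positive positive_eqP.

Section Trie.
Variable A : Type.

(** A finite map indexed by the binary digits of a positive, so that the large tables stay fast to
    compute with. *)
Inductive trie := Leaf | Node of trie & option A & trie.

Fixpoint tfind (k : positive) (t : trie) : option A :=
  match t, k with
  | Leaf, _ => None
  | Node _ o _, xH => o
  | Node l _ _, xO k' => tfind k' l
  | Node _ _ r, xI k' => tfind k' r
  end.

Fixpoint tadd (k : positive) (a : A) (t : trie) : trie :=
  match k, t with
  | xH, Leaf => Node Leaf (Some a) Leaf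
  | xO k', Leaf => Node (tadd k' a Leaf) None Leaf
  | xI k', Leaf => Node Leaf None (tadd k' a Leaf)
  | xH, Node l _ r => Node l (Some a) r
  | xO k', Node l o r => Node (tadd k' a l) o r
  | xI k', Node l o r => Node l o (tadd k' a r)
  end.

Fixpoint tmap (f : A -> A) (t : trie) : trie :=
  if t is Node l o r then Node (tmap f l) (omap f o) (tmap f r) else Leaf.

Lemma tfind_tmap f k t : tfind k (tmap f t) = omap f (tfind k t).
Proof. by elim: t k => [|l IHl o r IHr] [k|k|] //=. Qed.

Lemma tfind_tadd k a l t :
  tfind l (tadd k a t) = if l == k then Some a else tfind l t.
Proof.
have leaf m : tfind m Leaf = None by case: m.
by elim: k l t => [k IH|k IH|] [l|l|] [|tl o tr] //=; rewrite IH ?leaf.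
Qed.
End Trie.
Arguments Leaf {A}.

Definition row := seq (positive * Z).

(** Merge of rows sorted by key. Sortedness is never proved: [lincomb_radd] holds for all rows, and
    distinctness of keys is tested by [reduced_at] where it matters. *)
Fixpoint radd (r : row) : row -> row :=
  fix radd_r (s : row) : row :=
    match r, s with
    | [::], _ => s
    | _, [::] => r
    | (k, a) :: r', (l, b) :: s' =>
        match Pos.compare k l with
        | Eq => let c := Z.add a b in
                if Z.eqb c Z0 then radd r' s' else (k, c) :: radd r' s'
        | Lt => (k, a) :: radd r' s
        | Gt => (l, b) :: radd_r s'
        end
    end.

Definition rscale (c : Z) (r : row) : row := [seq (t.1, Z.mul c t.2) | t <- r].

Fixpoint rcoef (k : positive) (r : row) : Z :=
  if r is (l, a) :: r' then (if Pos.eqb k l then a else rcoef k r') else Z0.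

(** For 0, and for numbers with more than 99 prime factors 2 and 3, the result differs from the
    argument, so that [smooth] rejects them; every value returned is a unit of the field. *)
Fixpoint smooth_part (fuel : nat) (z : Z) : Z :=
  if fuel is n.+1 then
    if Z.eqb (Z.modulo z 2) Z0 then Z.mul 2 (smooth_part n (Z.div z 2))
    else if Z.eqb (Z.modulo z 3) Z0 then Z.mul 3 (smooth_part n (Z.div z 3))
    else Zpos xH
  else Zpos xH.

Definition smooth (z : Z) : bool := Z.eqb (smooth_part 99 (Z.abs z)) (Z.abs z).

(** Keeps the coefficients small by removing the factors 2 and 3 of their gcd. Multiplying back and
    comparing replaces a proof that the divisions are exact. *)
Definition rnorm (r : row) : row :=
  let d := smooth_part 99 (foldr (fun t => Z.gcd t.2) Z0 r) in
  if Z.eqb d (Zpos xH) then r else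
  let s := [seq (t.1, Z.div t.2 d) | t <- r] in
  if smooth d && (rscale d s == r) then s else r.

(* Eliminates [k] from [r] by means of [q], if the pivot is a product of powers
   of 2 and 3, up to sign. *)
Definition rstep (k : positive) (q r : row) : row :=
  let a := rcoef k r in
  if Z.eqb a Z0 then r else
  let b := rcoef k q in
  let g := Z.gcd a b in
  let b' := Z.div b g in
  let s := rscale (Z.opp (Z.div a g)) q in
  if Z.eqb b' (Zpos xH) then radd r s
  else if smooth b' then rnorm (radd (rscale b' r) s)
  else r.

(** As [gauss_step] clears each new pivot from the stored rows, subtracting one of them brings in no
    other pivot, so visiting the original keys of [r] is enough. A pivot that is not smooth may
    spoil this; the outcome is tested by [reduced_at]. *)
Definition reduce (m : trie row) (r : row) : row :=
  foldl (fun s t => if tfind t.1 m is Some q then rstep t.1 q s else s) r r.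

(** Prefers the smallest smooth coefficient as pivot; 10^9 is only an initial bound, and [k] is the
    fallback. *)
Definition min_key (k : positive) (r : row) : positive :=
  (foldl (fun m t => if Z.ltb (Z.abs t.2) m.1 && smooth t.2
                     then (Z.abs t.2, t.1) else m) (Z.pow 10 9, k) r).2.

Definition gauss_step (m : trie row) (kr : option positive * row) : trie row :=
  let r := reduce m kr.2 in
  if r is t :: _ then
    let k := odflt (min_key t.1 r) kr.1 in tadd k r (tmap (rstep k r) m)
  else m.

Definition gauss (rows : seq (option positive * row)) : trie row :=
  foldl gauss_step Leaf rows.

Definition is_pivot (m : trie row) (k : positive) : bool := isSome (tfind k m).

Definition reduced_at (dom : pred positive) (m : trie row) (k : positive) : bool :=
  if tfind k m is Some q then
    smooth (rcoef k q) &&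
    all (fun t => dom t.1 && ((t.1 == k) || ~~ is_pivot m t.1)) q &&
    uniq (unzip1 q)
  else true.

Definition solved_at (m : trie row) (k : positive) : bool :=
  if tfind k m is Some [:: (l, a)] then (l == k) && smooth a else false.

Definition zF (F : fieldType) (z : Z) : F := (int_of_Z z)%:~R.

Section Scalars.
Variable F : fieldType.
Local Notation zF := (@zF F).

Lemma zF0 : zF Z0 = 0. Proof. by []. Qed.
Lemma zF1 : zF (Zpos xH) = 1. Proof. by []. Qed.
Lemma zF2 : zF 2 = 2%:R. Proof. by []. Qed.
Lemma zF3 : zF 3 = 3%:R. Proof. by []. Qed.
Lemma zFD a b : zF (Z.add a b) = zF a + zF b.
Proof. by rewrite /zF (raddfD int_of_Z) rmorphD. Qed.
Lemma zFM a b : zF (Z.mul a b) = zF a * zF b.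
Proof. by rewrite /zF (rmorphM int_of_Z) rmorphM. Qed.
Lemma zFN a : zF (Z.opp a) = - zF a.
Proof. by rewrite /zF (raddfN int_of_Z) rmorphN. Qed.

Section Evaluation.
Variables (K : Type) (V : lmodType F) (p : K -> V).

Definition lincomb (r : seq (K * Z)) : V := \sum_(t <- r) zF t.2 *: p t.1.

Lemma lincomb_nil : lincomb [::] = 0. Proof. exact: big_nil. Qed.
Lemma lincomb_cons t r : lincomb (t :: r) = zF t.2 *: p t.1 + lincomb r.
Proof. exact: big_cons. Qed.
Lemma lincomb1 k : lincomb [:: (k, Zpos xH)] = p k.
Proof. by rewrite lincomb_cons lincomb_nil addr0 zF1 scale1r. Qed.
Lemma lincomb_cat r s : lincomb (r ++ s) = lincomb r + lincomb s.
Proof. exact: big_cat. Qed.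
Lemma lincomb_scale c (r : seq (K * Z)) :
  lincomb [seq (t.1, Z.mul c t.2) | t <- r] = zF c *: lincomb r.
Proof.
rewrite /lincomb big_map scaler_sumr; apply: eq_bigr => t _.
by rewrite zFM scalerA.
Qed.
End Evaluation.

Section Rows.
Variables (V : lmodType F) (p : positive -> V).
Local Notation evr := (@lincomb positive V p).

Lemma radd_cons k a r l b s : radd ((k, a) :: r) ((l, b) :: s) =
  match Pos.compare k l with
  | Eq => if Z.eqb (Z.add a b) Z0 then radd r s else (k, Z.add a b) :: radd r s
  | Lt => (k, a) :: radd r ((l, b) :: s)
  | Gt => (l, b) :: radd ((k, a) :: r) s
  end.
Proof. by []. Qed.

Lemma lincomb_radd r s : evr (radd r s) = evr r + evr s.
Proof.
elim: r s => [|[k a] r IHr] s; first by case: s => *; rewrite lincomb_nil add0r.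
elim: s => [|[l b] s IHs]; first by rewrite lincomb_nil addr0.
rewrite radd_cons; case: Pos.compare_spec => [<-|_|_]; last first.
- by rewrite lincomb_cons IHs !lincomb_cons addrCA.
- by rewrite lincomb_cons IHr !lincomb_cons addrA.
have E : zF (Z.add a b) *: p k + (evr r + evr s) =
    zF a *: p k + evr r + (zF b *: p k + evr s).
  by rewrite zFD scalerDl addrACA.
case: Z.eqb_spec => [ab0|_]; last by rewrite !lincomb_cons IHr.
by rewrite !lincomb_cons IHr -E ab0 zF0 scale0r add0r.
Qed.

End Rows.

Hypotheses (F2 : (2%:R : F) != 0) (F3 : (3%:R : F) != 0).

Lemma smooth_part_neq0 n z : zF (smooth_part n z) != 0.
Proof.
elim: n z => [|n IH] z; first by rewrite zF1 oner_neq0.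
rewrite -[smooth_part _ _]/(if _ then _ else if _ then _ else _).
case: ifP => _; last case: ifP => _; last by rewrite zF1 oner_neq0.
  by rewrite zFM mulf_eq0 negb_or IH zF2 F2.
by rewrite zFM mulf_eq0 negb_or IH zF3 F3.
Qed.

Lemma smooth_neq0 z : smooth z -> zF z != 0.
Proof.
rewrite /smooth; have := smooth_part_neq0 99 (Z.abs z); move: (smooth_part _ _) => s s0.
case: Z.eqb_spec => // E _; rewrite {s}E in s0.
by case: z s0 => // p; rewrite -[Zneg p]/(Z.opp (Zpos p)) zFN oppr_eq0.
Qed.

Section Kill.
Variables (V : lmodType F) (I : V -> Prop) (p : positive -> V).
Hypothesis subI : subspace I.
Local Notation evr := (@lincomb positive V p).

Lemma rnorm_kills r : I (evr r) -> I (evr (rnorm r)).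
Proof.
rewrite /rnorm; set d := smooth_part _ _; set s := map _ r.
case: ifP => // _; case: ifP => // /andP[/smooth_neq0 d0 /eqP E] Ir.
have -> : evr s = (zF d)^-1 *: evr r.
  by rewrite -E lincomb_scale scalerA mulVf // scale1r.
exact: subZ.
Qed.

Lemma rstep_kills k q r : I (evr q) -> I (evr r) -> I (evr (rstep k q r)).
Proof.
move=> Iq Ir; rewrite /rstep; case: ifP => // _.
case: ifP => _; first by rewrite lincomb_radd lincomb_scale; apply: subD => //; apply: subZ.
case: ifP => // _; apply: rnorm_kills; rewrite lincomb_radd !lincomb_scale.
by apply: subD => //; apply: subZ.
Qed.

(** The one invariant of elimination. It is used with [I] an ideal, where rows are relations between
    words, and with [I] the zero subspace of [F^o], where rows are linear equations for unknown
    scalars. *)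
Definition kills (m : trie row) : Prop := forall k q, tfind k m = Some q -> I (evr q).

Lemma reduce_kills m r : kills m -> I (evr r) -> I (evr (reduce m r)).
Proof.
move=> Im; rewrite /reduce; set f := (f in foldl f); move: {3}r => s.
elim: s r => //= t s IH r Ir; apply: IH; rewrite /f.
by case E: (tfind _ _) => [q|] //; apply: rstep_kills => //; apply: Im E.
Qed.

(** A step multiplies [r] by an invertible scalar and adds an element of [I], so it can be undone.
    Hence reduction to the empty row certifies membership in [I]. *)
Lemma rstep_reflects k q r : I (evr q) -> I (evr (rstep k q r)) -> I (evr r).
Proof.
move=> Iq; have norm s : I (evr (rnorm s)) -> I (evr s).
  rewrite /rnorm; set d := smooth_part _ _; case: ifP => // _.
  case: ifP => // /andP[_ /eqP E] Is; rewrite -E lincomb_scale; exact: subZ.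
have IqZ c : I (evr (rscale c q)) by rewrite lincomb_scale; apply: subZ.
have cancel u c : I (u + evr (rscale c q)) -> I u.
  by move=> Iu; rewrite -[u](addrK (evr (rscale c q))); apply: subB.
rewrite /rstep; case: ifP => // _; case: ifP => _; first by rewrite lincomb_radd => /cancel.
case: ifP => // /smooth_neq0 b0 /norm; rewrite lincomb_radd => /cancel.
rewrite lincomb_scale => /(subZ subI (zF (Z.div (rcoef k q) (Z.gcd (rcoef k r) (rcoef k q))))^-1).
by rewrite scalerA mulVf // scale1r.
Qed.

Lemma reduce_nil_kills m r : kills m -> reduce m r = [::] -> I (evr r).
Proof.
move=> Im; rewrite /reduce; set f := (f in foldl f); move: {2}r => s.
elim: s r => [|t s IH] r /= E; first by rewrite E lincomb_nil; apply: sub0.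
move: (IH _ E); rewrite /f; case E1: (tfind _ _) => [q|] //.
by apply: rstep_reflects; apply: Im E1.
Qed.

Lemma gauss_kills (rows : seq (option positive * row)) :
  (forall kr, kr \in rows -> I (evr kr.2)) -> kills (gauss rows).
Proof.
rewrite /gauss; set m0 := Leaf => Ir.
have: kills m0 by case.
elim: rows m0 Ir => //= kr rows IH m Ir Im; apply: IH => [q qr|].
  by apply: Ir; rewrite inE qr orbT.
have := reduce_kills Im (Ir _ (mem_head _ _)); rewrite /gauss_step.
case: (reduce _ _) => // t r; set k := odflt _ _; set r' := t :: r => Ir' l q.
rewrite tfind_tadd; case: ifP => [_ [<-]|_] //.
rewrite tfind_tmap; case E: (tfind l m) => [s|] //= [<-].
by apply: rstep_kills => //; apply: Im E.
Qed.
End Kill.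

Lemma solved_eq0 m (d : positive -> F) k :
  kills (fun v => v = 0) (d : positive -> F^o) m -> solved_at m k -> d k = 0.
Proof.
rewrite /solved_at => Hm; case E: (tfind k m) => [[|[l a] [|]]|] //.
case/andP => /eqP kl /smooth_neq0 a0; subst l.
move: (Hm _ _ E); rewrite lincomb_cons lincomb_nil addr0 => /eqP.
by rewrite mulf_eq0 (negPf a0) => /eqP.
Qed.

Lemma rcoefE r k : uniq (unzip1 r) -> forall (V : lmodType F) (p : positive -> V),
  lincomb p r = zF (rcoef k r) *: p k + \sum_(t <- r | t.1 != k) zF t.2 *: p t.1.
Proof.
move=> + V p; elim: r => [|[l a] r IH] /=.
  by rewrite lincomb_nil big_nil zF0 scale0r addr0.
case/andP=> lr ur; rewrite lincomb_cons big_cons /=; case: Pos.eqb_spec => [E|kl].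
  rewrite E eqxx /=; congr (_ + _); rewrite /lincomb [RHS]big_mkcond big_seq [RHS]big_seq.
  apply: eq_bigr => t tr; case: eqP => // tl; case/negP: lr.
  by rewrite -tl; apply: map_f.
by case: eqP => [lk|_]; [case: kl|rewrite IH // addrCA].
Qed.

(* [m] rewrites the generators in [W] to those which are not pivots, and linear
   combinations of the latter are separated by the functionals [val j]. *)
Lemma separation (W : seq positive) (dom : pred positive) (m : trie row)
    (J : eqType) (js : seq (option positive * J)) (val : J -> positive -> Z) :
  let N := [seq w <- W | ~~ is_pivot m w] in
  uniq W ->
  {subset dom <= W} ->
  all (reduced_at dom m) W ->
  all (solved_at (gauss
    [seq (kj.1, [seq t <- [seq (b, val kj.2 b) | b <- N] | t.2 != Z0]) | kj <- js])) N ->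
  (forall kj, kj \in js -> kills (fun v => v = 0) (fun w => zF (val kj.2 w) : F^o) m) ->
  forall (c : positive -> F),
  (forall kj, kj \in js -> \sum_(w <- W) c w * zF (val kj.2 w) = 0) ->
  forall (V : lmodType F) (I : V -> Prop) (p : positive -> V), subspace I ->
  kills I p m -> I (\sum_(w <- W) c w *: p w).
Proof.
move=> N uW domW /allP redW /allP slv valK c cJ V I p subI Ip.
have uN : uniq N by apply: filter_uniq.
(* [nu w b] is the coordinate of [w] at the non-pivot [b] modulo the relations. *)
pose nu w b : F := if tfind w m is Some q then
   - (zF (rcoef w q))^-1 * zF (rcoef b q) else (b == w)%:R.
have nuP w : w \in W ->
    forall (V : lmodType F) (I : V -> Prop) (p : positive -> V), subspace I ->
    kills I p m -> I (p w - \sum_(b <- N) nu w b *: p b).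
  move=> wW V' I' p' sI Hp; have := redW w wW; rewrite /reduced_at /nu.
  case E: (tfind w m) => [q|] => [/andP[/andP[/smooth_neq0 a0 /allP qN] uq]|_]; last first.
    have wN : w \in N by rewrite mem_filter /is_pivot E.
    rewrite (bigD1_seq w) //= eqxx scale1r big1_seq ?addr0; first exact: cong_refl.
    by move=> b /andP[/negPf-> _]; rewrite scale0r.
  have := subZ sI (zF (rcoef w q))^-1 (Hp _ _ E).
  rewrite (rcoefE w uq) scalerDr scalerA mulVf // scale1r.
  congr (I' (_ + _)); rewrite scaler_sumr -sumrN.
  under [RHS]eq_bigr => b do rewrite mulNr scaleNr opprK -scalerA.
  rewrite -!scaler_sumr; congr (_ *: _).
  transitivity (\sum_(t <- q | t.1 != w) zF (rcoef t.1 q) *: p' t.1).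
    rewrite big_seq_cond [RHS]big_seq_cond; apply: eq_bigr => t /andP[tq _].
    congr (zF _ *: _); elim: q uq tq {E a0 qN} => //= -[k a] q IH /andP[kq uq].
    rewrite inE => /orP[/eqP->|tq] /=; first by rewrite Pos.eqb_refl.
    case: Pos.eqb_spec => [E|_]; last exact: IH.
    by case/negP: kq; rewrite /= -E; apply: map_f.
  transitivity (\sum_(k <- unzip1 q | k != w) zF (rcoef k q) *: p' k).
    by rewrite big_map.
  rewrite -big_filter; set S := filter _ _.
  have uS : uniq S by apply: filter_uniq.
  have SN : {subset S <= N}.
    move=> k; rewrite mem_filter => /andP[kw /mapP[t tq E1]]; rewrite mem_filter E1.
    have /andP[/domW tW /orP[/eqP E2|tp]] := qN _ tq; last by rewrite tp tW.
    by rewrite E1 E2 eqxx in kw.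
  have out k : k \in N -> k \notin S -> rcoef k q = Z0.
    rewrite mem_filter => /andP[kp _]; rewrite mem_filter negb_and negbK => /orP[/eqP kw|].
      by rewrite kw /is_pivot E in kp.
    by elim: (q) => //= -[l a] r IH; rewrite inE negb_or => /andP[/eqP kl /IH ->]; case: Pos.eqb_spec.
  rewrite [RHS](bigID [in S]) /= [X in _ + X]big1_seq ?addr0; last first.
    by move=> k /andP[kS kN]; rewrite out // zF0 scale0r.
  rewrite -[RHS]big_filter; apply/perm_big/uniq_perm => //; first exact: filter_uniq.
  by move=> k; rewrite [RHS]mem_filter andb_idr //; apply: SN.
(* The coordinates of the whole combination at the non-pivots. Each functional gives a linear
   equation for them, and the solved system forces them all to be 0. *)
pose d b := \sum_(w <- W) c w * nu w b.
have d0 b : b \in N -> d b = 0.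
  move=> bN; apply: (@solved_eq0 _ d b _ (slv _ bN)).
  apply: gauss_kills; first exact: subspace_eq0.
  move=> kr /mapP[kj jJ ->] /=; rewrite /lincomb big_filter big_mkcond big_map /=.
  transitivity (\sum_(j <- N) zF (val kj.2 j) * d j).
    apply: eq_bigr => j _; case: eqP => //= E; by rewrite E zF0 mul0r.
  rewrite -[RHS](cJ _ jJ) /d; under eq_bigr do rewrite mulrC mulr_suml.
  rewrite exchange_big /= !big_seq; apply: eq_bigr => w wW.
  under eq_bigr do rewrite -mulrA; rewrite -mulr_sumr; congr (_ * _).
  apply/esym/eqP; rewrite -subr_eq0; apply/eqP.
  (* [nuP] is applied to the functional itself, as a map to [F^o] with the zero subspace: the
     functional takes the same value on [w] and on its reduction. *)
  exact: (nuP w wW F^o _ (fun w => zF (val kj.2 w)) (@subspace_eq0 _ _) (valK _ jJ)).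
apply: (@cong_sub _ _ _ subI _ (\sum_(w <- W) c w *: \sum_(b <- N) nu w b *: p b)).
  rewrite -sumrB; apply: sub_sum => // w wW _; rewrite -scalerBr; apply: subZ => //.
  exact: nuP.
under eq_bigr do rewrite scaler_sumr; rewrite exchange_big /=.
apply: sub_sum => // b bN _; under eq_bigr do rewrite scalerA.
by rewrite -scaler_suml -/(d b) d0 // scale0r; apply: sub0.
Qed.
End Scalars.

(** * Right operators of a Malcev dialgebra *)

(** A product of operators: [[:: a]] stands for R_a and [[:: a; b]] for R_(ab). *)
Definition word := seq (seq nat).

Definition rneg (K : Type) (r : seq (K * Z)) : seq (K * Z) :=
  [seq (t.1, Z.mul (Zneg xH) t.2) | t <- r].

Definition wmul (l m : seq (word * Z)) : seq (word * Z) :=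
  [seq (t.1 ++ s.1, Z.mul t.2 s.2) | t <- l, s <- m].

(* In a right Malcev dialgebra [R_((bc)d) = R_b R_c R_d - R_d R_b R_c - R_(cd) R_b - R_c R_(bd)],
   operators being composed from left to right. *)
Fixpoint Rexp (n : nat) (u : magma) : seq (word * Z) :=
  if n is n'.+1 then
    let R := Rexp n' in
    let formula b c d :=
      wmul (R b) (wmul (R c) (R d)) ++ rneg (wmul (R d) (wmul (R b) (R c))) ++
      rneg (wmul (R (MMul c d)) (R b)) ++ rneg (wmul (R c) (R (MMul b d))) in
    match u with
    | MVar a => [:: ([:: [:: a]], Zpos xH)]
    | MMul (MVar a) (MVar b) =>
        if (a < b)%N then [:: ([:: [:: a; b]], Zpos xH)] else [:: ([:: [:: b; a]], Zneg xH)]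
    | MMul (MMul b c) d => formula b c d
    | MMul (MVar a) (MMul c d) => rneg (formula c d (MVar a))
    end
  else [::].

Section Bilinear.
Variables (F : fieldType) (V : lmodType F) (op : V -> V -> V).
Hypothesis bil : bilinear_for *:%R *:%R op.

Lemma bilDl u v w : op (u + v) w = op u w + op v w.
Proof. by have := bil.1 w 1 u v; rewrite /= !scale1r. Qed.
Lemma bilDr u v w : op w (u + v) = op w u + op w v.
Proof. by have := bil.2 w 1 u v; rewrite /= !scale1r. Qed.
Lemma bil0l w : op 0 w = 0.
Proof. by apply: (addrI (op 0 w)); rewrite -bilDl !addr0. Qed.
Lemma bil0r w : op w 0 = 0.
Proof. by apply: (addrI (op w 0)); rewrite -bilDr !addr0. Qed.
Lemma bilZl c u w : op (c *: u) w = c *: op u w.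
Proof. by have := bil.1 w c u 0; rewrite /= bil0l !addr0. Qed.
Lemma bilZr c u w : op w (c *: u) = c *: op w u.
Proof. by have := bil.2 w c u 0; rewrite /= bil0r !addr0. Qed.
Lemma bilNl u w : op (- u) w = - op u w.
Proof. by rewrite -scaleN1r bilZl scaleN1r. Qed.
Lemma bilBl u v w : op (u - v) w = op u w - op v w.
Proof. by rewrite bilDl bilNl. Qed.
Lemma bil_suml (T : Type) (r : seq T) (P : pred T) (f : T -> V) w :
  op (\sum_(t <- r | P t) f t) w = \sum_(t <- r | P t) op (f t) w.
Proof. by apply: (big_morph (op^~ w)) => [u v|]; rewrite ?bilDl ?bil0l. Qed.
Lemma bil_sumr (T : Type) (r : seq T) (P : pred T) (f : T -> V) w :
  op w (\sum_(t <- r | P t) f t) = \sum_(t <- r | P t) op w (f t).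
Proof. by apply: (big_morph (op w)) => [u v|]; rewrite ?bilDr ?bil0r. Qed.
End Bilinear.

Lemma bilinearI (F : fieldType) (V : lmodType F) (op : V -> V -> V) :
  (forall c u v w, op (c *: u + v) w = c *: op u w + op v w) ->
  (forall c u v w, op w (c *: u + v) = c *: op w u + op w v) ->
  bilinear_for *:%R *:%R op.
Proof. by move=> L R; split=> w c u v /=; rewrite ?L ?R. Qed.

Definition di_Malcev (F : fieldType) (V : lmodType F) (op : V -> V -> V) (a b c d : V) : V :=
  op (op (op a b) c) d - op (op (op a d) b) c - op (op a (op c d)) b
  - op (op a c) (op b d) - op a (op (op b c) d).

(** Two instances matter: a T-ideal in the free algebra, and the zero ideal in the commutator
    algebra of an alternative algebra. The reduction to words is done once for both. *)
Record malcev_ideal (F : fieldType) (V : lmodType F) (op : V -> V -> V)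
    (I : V -> Prop) : Prop := MalcevIdeal {
  mi_sub : subspace I;
  mi_bil : bilinear_for *:%R *:%R op;
  mi_ideal : forall u v, I u -> I (op u v) /\ I (op v u);
  mi_anti : forall a b c, I (op a (op b c) + op a (op c b));
  mi_malcev : forall a b c d, I (di_Malcev op a b c d) }.

Section Words.
Variables (F : fieldType) (V : lmodType F) (op : V -> V -> V) (I : V -> Prop).
Hypothesis mi : malcev_ideal op I.
Variable x : nat -> V.

Let sI := mi_sub mi.
Let bil := mi_bil mi.

Definition act (v : V) (g : seq nat) : V :=
  match g with
  | [:: a] => op v (x a)
  | [:: a; b] => op v (op (x a) (x b))
  | _ => 0
  end.

Definition acts (v : V) (w : word) : V := foldl act v w.

Local Notation "u == v" := (I (u - v)).
Local Notation ev := (magma_eval op x).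

Lemma actL c u v g : act (c *: u + v) g = c *: act u g + act v g.
Proof.
by case: g => [|a [|b [|d g]]]; rewrite /= ?scaler0 ?addr0 // bilDl // bilZl.
Qed.

Lemma actsL c u v w : acts (c *: u + v) w = c *: acts u w + acts v w.
Proof. by elim: w u v => //= g w IH u v; rewrite actL IH. Qed.

Lemma acts_sum (r : seq (word * Z)) (f : word -> V) w :
  acts (\sum_(t <- r) zF F t.2 *: f t.1) w = \sum_(t <- r) zF F t.2 *: acts (f t.1) w.
Proof.
elim: r => [|t r IH]; last by rewrite !big_cons actsL IH.
rewrite !big_nil; have := actsL 1 0 0 w; rewrite !scale1r addr0.
by move/(congr1 (fun u => u - acts 0 w)); rewrite subrr addrK.
Qed.

Lemma acts_ideal v w : I v -> I (acts v w).
Proof.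
elim: w v => //= g w IH v Iv; apply: IH.
case: g => [|a [|b [|d g]]] /=; try exact: sub0.
  by case: (mi_ideal mi (x a) Iv).
by case: (mi_ideal mi (op (x a) (x b)) Iv).
Qed.

Definition evw (v : V) (l : seq (word * Z)) : V := lincomb (acts v) l.

Lemma evw_wmul v l m : evw v (wmul l m) = evw (evw v l) m.
Proof.
rewrite /evw {1}/lincomb /wmul big_allpairs_dep /= exchange_big /= [RHS]/lincomb.
apply: eq_bigr => s _; rewrite acts_sum scaler_sumr; apply: eq_bigr => t _.
by rewrite /acts foldl_cat zFM scalerA mulrC.
Qed.

Lemma evw_rneg v l : evw v (rneg l) = - evw v l.
Proof. by rewrite /evw /rneg lincomb_scale -[Zneg xH]/(Z.opp (Zpos xH)) zFN zF1 scaleN1r. Qed.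

Lemma evw_cat v l m : evw v (l ++ m) = evw v l + evw v m.
Proof. exact: lincomb_cat. Qed.

Lemma cong_opl a b c : a == b -> op a c == op b c.
Proof. by move=> ab; rewrite -(bilBl bil); case: (mi_ideal mi c ab). Qed.
Lemma right_formula v b c d : op v (op (op b c) d) ==
  op (op (op v b) c) d + (- op (op (op v d) b) c + (- op (op v (op c d)) b
    - op (op v c) (op b d))).
Proof. by rewrite !addrA -[X in I X]opprB; apply: subN => //; apply: (mi_malcev mi). Qed.

Lemma mulC_right v b c : op v (op b c) == - op v (op c b).
Proof. by rewrite opprK; apply: (mi_anti mi). Qed.

Lemma magma_size_gt0 (u : magma) : (0 < magma_size u)%N.
Proof. by elim: u => //= u Hu v Hv; rewrite addn_gt0 Hu. Qed.

(** All arguments on the right-hand side of the formula for R_((bc)d), including cd and bd, are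
    smaller than (bc)d; this is why the size is sufficient fuel. *)
Lemma Rexp_sound n u v : (magma_size u <= n)%N -> op v (ev u) == evw v (Rexp n u).
Proof.
elim: n u v => [|n IH] u v; first by have := magma_size_gt0 u; case: (magma_size u).
have comp a b (w1 w2 : V) : (magma_size b <= n)%N -> w1 == evw v a ->
    op w1 (ev b) == evw v (wmul a (Rexp n b)).
  move=> sb H; rewrite evw_wmul; apply: (cong_trans sI _ (IH _ _ sb)).
  exact: cong_opl.
have F3 b c d : (magma_size b + magma_size c + magma_size d <= n.+1)%N ->
    op v (op (op (ev b) (ev c)) (ev d)) == evw v
     (wmul (Rexp n b) (wmul (Rexp n c) (Rexp n d)) ++
      rneg (wmul (Rexp n d) (wmul (Rexp n b) (Rexp n c))) ++
      rneg (wmul (Rexp n (MMul c d)) (Rexp n b)) ++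
      rneg (wmul (Rexp n c) (Rexp n (MMul b d)))).
  move=> sz; have := magma_size_gt0 b; have := magma_size_gt0 c.
  have := magma_size_gt0 d => sd sc sb.
  have [lb lc ld] : [/\ magma_size b <= n, magma_size c <= n & magma_size d <= n]%N.
    by split; lia.
  have lcd : (magma_size (MMul c d) <= n)%N by rewrite /=; lia.
  have lbd : (magma_size (MMul b d) <= n)%N by rewrite /=; lia.
  have W3 a1 a2 a3 : (magma_size a1 <= n)%N -> (magma_size a2 <= n)%N ->
      (magma_size a3 <= n)%N -> op (op (op v (ev a1)) (ev a2)) (ev a3) ==
      evw v (wmul (Rexp n a1) (wmul (Rexp n a2) (Rexp n a3))).
    move=> l1 l2 l3; rewrite !evw_wmul.
    apply: (cong_trans sI _ (IH _ _ l3)); apply: cong_opl.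
    apply: (cong_trans sI _ (IH _ _ l2)); apply: cong_opl.
    exact: IH.
  have W2 a1 a2 : (magma_size a1 <= n)%N -> (magma_size a2 <= n)%N ->
      op (op v (ev a1)) (ev a2) == evw v (wmul (Rexp n a1) (Rexp n a2)).
    move=> l1 l2; rewrite !evw_wmul.
    by apply: (cong_trans sI _ (IH _ _ l2)); apply: cong_opl; apply: IH.
  apply: (cong_trans sI (right_formula _ _ _ _)).
  rewrite !evw_cat !evw_rneg; apply: (congD sI); first exact: W3.
  apply: (congD sI); first by apply: (congN sI); apply: W3.
  by apply: (congD sI); apply: (congN sI); [apply: (W2 (MMul c d))|apply: (W2 c (MMul b d))].
case: u => [a|[a|b c] d] /= sz.
- by rewrite /evw lincomb_cons lincomb_nil addr0 zF1 scale1r; apply: (cong_refl sI).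
- case: d sz => [b|c d] sz.
    case: ifP => _; rewrite /evw lincomb_cons lincomb_nil addr0 /=.
      by rewrite zF1 scale1r; apply: (cong_refl sI).
    rewrite -[zF F _]/(-1) scaleN1r; apply: mulC_right.
  rewrite evw_rneg; apply: (cong_trans sI (mulC_right _ _ _)); apply: (congN sI).
  by apply: (F3 c d (MVar a)); move: sz => /=; lia.
- exact: F3.
Qed.

Fixpoint spine (w : magma) : seq (word * Z) :=
  if w is MMul u v then wmul (spine u) (Rexp (magma_size v) v)
  else [:: ([::], Zpos xH)].

Fixpoint head_leaf (w : magma) : nat :=
  match w with MVar i => i | MMul u _ => head_leaf u end.

Lemma spine_sound w : ev w == evw (x (head_leaf w)) (spine w).
Proof.
elim: w => [i|u IHu v _] /=.
  by rewrite /evw lincomb_cons lincomb_nil addr0 zF1 scale1r; apply: (cong_refl sI).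
rewrite evw_wmul; apply: (cong_trans sI _ (@Rexp_sound _ _ _ (leqnn _))).
exact: cong_opl.
Qed.

(* [R_((bc)d) + R_((cb)d)] vanishes, but its expansion into words does not. *)
Definition swap_relation (b c d : magma) : seq (word * Z) :=
  let n := (magma_size b + magma_size c + magma_size d)%N in
  Rexp n (MMul (MMul b c) d) ++ Rexp n (MMul (MMul c b) d).

Definition in_context (l : word) (t : seq (word * Z)) (r : word) : seq (word * Z) :=
  [seq (l ++ s.1 ++ r, s.2) | s <- t].

Lemma evw_in_context v l t r : evw v (in_context l t r) = acts (evw (acts v l) t) r.
Proof.
rewrite /evw acts_sum /lincomb /in_context big_map; apply: eq_bigr => s _.
by rewrite /acts !foldl_cat.
Qed.

(** Right anticommutativity moves d in front and turns the sum into -v(d(bc) + d(cb)), whose right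
    factor is again an instance of right anticommutativity. *)
Lemma swap_relation_kills v b c d : I (evw v (swap_relation b c d)).
Proof.
rewrite evw_cat; set n := (_ + _)%N.
apply: (@cong_sub _ _ _ sI _ (op v (ev (MMul (MMul b c) d)) + op v (ev (MMul (MMul c b) d)))).
  apply: (congD sI); apply: cong_sym => //; apply: Rexp_sound; rewrite /= /n; lia.
rewrite /=; set B := ev b; set C := ev c; set D := ev d.
have -> : op v (op (op B C) D) + op v (op (op C B) D) =
   op v (op (op B C) D) + op v (op D (op B C)) +
   (op v (op (op C B) D) + op v (op D (op C B))) -
   op v (op D (op B C) + op D (op C B)).
  by rewrite (bilDr bil) addrACA addrK.
apply: subB => //; first by apply: subD => //; apply: (mi_anti mi).
by case: (mi_ideal mi v (mi_anti mi D B C)).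
Qed.

End Words.

(** * Relations between words and functionals separating them *)

Local Open Scope nat_scope.

(** The order of this list fixes the numbers of the words, to which the prescribed pivots in the
    tables of functionals refer. *)
Fixpoint words (n : nat) (s : seq nat) : seq word :=
  if s is [::] then [:: [::]] else
  if n is n'.+1 then
    flatten [seq
      [seq [:: a] :: w | w <- words n' (rem a s)] ++
      flatten [seq [seq [:: a; b] :: w | w <- words n' (rem a (rem b s))] | b <- s & a < b]
    | a <- s]
  else [::].

Fixpoint code_word (w : word) : positive :=
  if w is g :: w' then
    foldr (fun a k => xI (iter a xI (xO k))) (xO (code_word w')) g
  else xH.

Section Interning.
Variables (K : eqType) (code : K -> positive).

Fixpoint index_trie (i : positive) (s : seq K) (t : trie (positive * K)) :=
  if s is k :: s' then index_trie (Pos.succ i) s' (tadd (code k) (i, k) t) else t.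

(** The original key is stored along with its number and compared, so injectivity of [code] need not
    be proved: a collision only yields [None]. *)
Fixpoint intern (t : trie (positive * K)) (r : seq (K * Z)) : option row :=
  if r is (k, a) :: r' then
    if (tfind (code k) t, intern t r') is (Some (i, l), Some s) then
      if k == l then Some (radd [:: (i, a)] s) else None
    else None
  else Some [::].
End Interning.

Fixpoint splits (s : seq nat) : seq (seq nat * seq nat) :=
  if s is a :: s' then
    [seq (a :: t.1, t.2) | t <- splits s'] ++ [seq (t.1, a :: t.2) | t <- splits s']
  else [:: ([::], [::])].

(** The first letter stays in the left factor: one of the two orders of each product is enough,
    since operators are taken modulo anticommutativity. *)
Fixpoint monomials (n : nat) (s : seq nat) : seq magma :=
  if n is n'.+1 then
    match s with
    | [::] => [::]
    | [:: a] => [:: MVar a]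
    | a :: s' => flatten [seq
        [seq MMul u v | u <- monomials n' (a :: t.1), v <- monomials n' t.2] | t <- splits s']
    end
  else [::].

Definition core_relations (s : seq nat) : seq (seq (word * Z)) :=
  flatten [seq flatten [seq
     [seq swap_relation b (MVar (head 0 s2.1)) (MVar (head 0 s2.2)) | b <- monomials 3 s1.1]
       | s2 <- splits s1.2 & (size s2.1 == 1) && (head 0 s1.1 < head 0 s2.1)]
       | s1 <- splits s & size s1.2 == 2].

(** Swap relations on 3, 4 or 5 letters, multiplied by words on both sides. Any family of valid
    relations would be sound; that this one is large enough is decided by [separation_check]. *)
Definition relations (n : nat) : seq (seq (word * Z)) :=
  flatten [seq flatten [seq
      let core := core_relations s.1 in
      flatten [seq
         [seq in_context lr.1 t lr.2 |
            t <- core, lr <- [seq (l, r) | l <- words 6 c.1, r <- words 6 c.2]]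
        | c <- splits s.2]
    | s <- splits (iota 1 n) & size s.1 == k] | k <- iota 3 3].

Definition relation_rows (n : nat) : seq row :=
  let t := index_trie code_word xH (words n (iota 1 n)) Leaf in
  pmap (intern code_word t) (relations n).

Definition pivots (n : nat) : trie row := gauss [seq (None, r) | r <- relation_rows n].

Record structure_constants := StructureConstants {
  sc_odd : bool;
  sc_basis : seq nat;
  sc_parity : nat -> bool;
  sc_mul : nat -> nat -> seq (nat * Z) }.

(* Zorn vector matrices: 0, 1 are the diagonal idempotents, 2, 3, 4 and 5, 6, 7 the
   bases of the two copies of 3-space. *)
Definition octonion_table : seq (seq (seq (nat * Z))) := [::
  [:: [:: (0, Zpos xH)]; [::]; [:: (2, Zpos xH)]; [:: (3, Zpos xH)]; [:: (4, Zpos xH)]; [::]; [::]; [::]];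
  [:: [::]; [:: (1, Zpos xH)]; [::]; [::]; [::]; [:: (5, Zpos xH)]; [:: (6, Zpos xH)]; [:: (7, Zpos xH)]];
  [:: [::]; [:: (2, Zpos xH)]; [::]; [:: (7, Zpos xH)]; [:: (6, Zneg xH)]; [:: (0, Zpos xH)]; [::]; [::]];
  [:: [::]; [:: (3, Zpos xH)]; [:: (7, Zneg xH)]; [::]; [:: (5, Zpos xH)]; [::]; [:: (0, Zpos xH)]; [::]];
  [:: [::]; [:: (4, Zpos xH)]; [:: (6, Zpos xH)]; [:: (5, Zneg xH)]; [::]; [::]; [::]; [:: (0, Zpos xH)]];
  [:: [:: (5, Zpos xH)]; [::]; [:: (1, Zpos xH)]; [::]; [::]; [::]; [:: (4, Zneg xH)]; [:: (3, Zpos xH)]];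
  [:: [:: (6, Zpos xH)]; [::]; [::]; [:: (1, Zpos xH)]; [::]; [:: (4, Zpos xH)]; [::]; [:: (2, Zneg xH)]];
  [:: [:: (7, Zpos xH)]; [::]; [::]; [::]; [:: (1, Zpos xH)]; [:: (3, Zneg xH)]; [:: (2, Zpos xH)]; [::]]].

(* Products of basis vectors in a nilpotent alternative superalgebra generated by two
   odd elements [x], [y] (the basis vectors 0 and 1) and homogeneous of type up to
   [x^4 y^2]; found by computer. *)
Definition nil_entries : seq (nat * nat * seq (nat * Z)) := [::
  ((0, 0), [:: (2, Zpos xH)]);
  ((0, 1), [:: (4, Zpos xH)]);
  ((0, 2), [:: (5, Zpos xH)]);
  ((0, 3), [:: (7, Zpos xH)]);
  ((0, 4), [:: (8, Zpos xH)]);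
  ((0, 5), [:: (10, Zpos xH)]);
  ((0, 7), [:: (12, Zpos xH)]);
  ((0, 8), [:: (11, Zneg xH); (12, Zpos xH)]);
  ((0, 9), [:: (13, Zpos xH)]);
  ((0, 12), [:: (14, Zneg xH)]);
  ((0, 13), [:: (15, Zpos xH)]);
  ((1, 0), [:: (3, Zpos xH)]);
  ((1, 2), [:: (6, Zpos xH)]);
  ((1, 5), [:: (11, Zpos xH)]);
  ((1, 10), [:: (14, Zpos xH)]);
  ((1, 15), [:: (16, Zpos xH)]);
  ((2, 0), [:: (5, Zpos xH)]);
  ((2, 1), [:: (6, Zneg xH); (8, Zpos xH); (9, Zpos xH)]);
  ((2, 2), [:: (10, Zpos xH)]);
  ((2, 4), [:: (11, Zneg xH); (12, Zpos xH); (13, Zpos xH)]);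
  ((2, 8), [:: (14, Zneg xH); (15, Zpos xH)]);
  ((3, 0), [:: (9, Zpos xH)]);
  ((3, 2), [:: (11, Zpos xH)]);
  ((3, 5), [:: (14, Zpos xH)]);
  ((3, 12), [:: (16, Zpos xH)]);
  ((4, 0), [:: (6, Zneg xH); (7, Zpos xH); (9, Zpos xH)]);
  ((4, 12), [:: (16, Zpos xH)]);
  ((4, 13), [:: (16, Zneg xH)]);
  ((5, 0), [:: (10, Zpos xH)]);
  ((5, 1), [:: (11, Zneg xH); (12, Zpos xH); (13, Zpos xH)]);
  ((5, 4), [:: (14, Zneg xH); (15, Zpos xH)]);
  ((6, 0), [:: (11, Zpos xH)]);
  ((6, 2), [:: (14, Zpos xH)]);
  ((6, 8), [:: (16, Zpos xH)]);
  ((7, 0), [:: (12, Zpos xH); (13, Zpos xH)]);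
  ((7, 7), [:: (16, Zpos xH)]);
  ((7, 8), [:: (16, Zpos xH)]);
  ((7, 9), [:: (16, Zneg xH)]);
  ((8, 0), [:: (12, Zpos xH)]);
  ((8, 8), [:: (16, Zpos xH)]);
  ((8, 9), [:: (16, Zneg xH)]);
  ((9, 0), [:: (11, Zpos xH); (12, Zneg xH)]);
  ((9, 2), [:: (14, Zpos xH)]);
  ((9, 9), [:: (16, Zpos xH)]);
  ((10, 1), [:: (14, Zneg xH); (15, Zpos xH)]);
  ((11, 0), [:: (14, Zpos xH)]);
  ((11, 4), [:: (16, Zpos xH)]);
  ((12, 0), [:: (15, Zpos xH)]);
  ((12, 3), [:: (16, Zneg xH)]);
  ((13, 0), [:: (14, Zpos xH); (15, Zneg xH)]);
  ((13, 3), [:: (16, Zpos xH)]);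
  ((13, 4), [:: (16, Zpos xH)]);
  ((14, 1), [:: (16, Zpos xH)]);
  ((15, 1), [:: (16, Zpos xH)])].

(* The pair [(i, j)] is encoded by [7 i + j]. *)
Definition matrix_algebra := StructureConstants false
  [seq ij <- iota 0 49 | ij %/ 7 < ij %% 7] (fun=> false)
  (fun a b => if a %% 7 == b %/ 7 then [:: (7 * (a %/ 7) + b %% 7, Zpos xH)] else [::]).

Definition octonions := StructureConstants false (iota 0 8) (fun=> false)
  (fun a b => nth [::] (nth [::] octonion_table a) b).

Fixpoint assoc_find (k : nat * nat) (s : seq (nat * nat * seq (nat * Z))) : seq (nat * Z) :=
  if s is (l, u) :: s' then (if (k.1 == l.1) && (k.2 == l.2) then u else assoc_find k s') else [::].

Definition nil_table : seq (seq (seq (nat * Z))) :=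
  [seq [seq assoc_find (a, b) nil_entries | b <- iota 0 17] | a <- iota 0 17].

(** The basis vectors 0-1, 2-4, 5-9, 10-13, 14-15 and 16 have degrees 1 to 6, and parity is that of
    the degree. The vector 16 spans type x^4 y^2, so the functionals on this algebra have four
    letters 0 and two letters 1. *)
Definition nil_superalgebra := StructureConstants true (iota 0 17)
  (fun a => (a < 2) || (4 < a < 10) || (13 < a < 16))
  (fun a b => nth [::] (nth [::] nil_table a) b).

Definition algebra_of (i : nat) : structure_constants :=
  match i with 0 => matrix_algebra | 1 => octonions | _ => nil_superalgebra end.

Definition acomb := seq (nat * Z).

Definition scale_comb (c : Z) (u : acomb) : acomb := [seq (t.1, Z.mul c t.2) | t <- u].

Definition amul (A : structure_constants) (u v : acomb) : acomb :=
  flatten [seq flatten [seq scale_comb (Z.mul s.2 t.2) (sc_mul A s.1 t.1) | t <- v] | s <- u].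

Fixpoint insert_comb (k : nat) (a : Z) (u : acomb) : acomb :=
  if u is (l, b) :: u' then
    if k == l then
      let c := Z.add a b in if Z.eqb c Z0 then u' else (l, c) :: u'
    else (l, b) :: insert_comb k a u'
  else [:: (k, a)].

Definition collect (u : acomb) : acomb := foldr (fun t => insert_comb t.1 t.2) [::] u.

Fixpoint comb_coef (k : nat) (u : acomb) : Z :=
  if u is (l, a) :: u' then Z.add (if k == l then a else Z0) (comb_coef k u') else Z0.

(* Masks stand for the monomials of the exterior algebra on 6 generators if
   [sc_odd A], and of its commutative analogue with vanishing squares otherwise. *)
Definition mask := seq bool.

Fixpoint munion (S T : mask) : mask :=
  match S, T with s :: S', t :: T' => (s || t) :: munion S' T' | _, _ => [::] end.

Fixpoint mdisjoint (S T : mask) : bool :=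
  match S, T with s :: S', t :: T' => ~~ (s && t) && mdisjoint S' T' | _, _ => true end.

(* Parity of the number of pairs [(i, j)] with [i] in [S], [j] in [T] and [j < i]. *)
Fixpoint minversions (S T : mask) : bool :=
  match S, T with
  | s :: S', t :: T' => (t && odd (count id S')) (+) minversions S' T'
  | _, _ => false
  end.

Definition sign_of (b : bool) : Z := if b then Zneg xH else Zpos xH.

Definition msign (A : structure_constants) (S T : mask) : bool :=
  sc_odd A && minversions S T.

(** Commutator in the envelope of two elements each carried by one Grassmann monomial; the negation
    in the second sign is the minus of the commutator. *)
Definition hcom (A : structure_constants) (x y : mask * acomb) : mask * acomb :=
  (munion x.1 y.1,
   if mdisjoint x.1 y.1 then
     collect (scale_comb (sign_of (msign A x.1 y.1)) (amul A x.2 y.2) ++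
              scale_comb (sign_of (~~ msign A y.1 x.1)) (amul A y.2 x.2))
   else [::]).

Definition vanishing (u : acomb) : bool := all (fun t => comb_coef t.1 u == Z0) u.

Definition associator (A : structure_constants) (a b c : nat) : acomb :=
  amul A (amul A [:: (a, Zpos xH)] [:: (b, Zpos xH)]) [:: (c, Zpos xH)] ++
  scale_comb (Zneg xH) (amul A [:: (a, Zpos xH)] (amul A [:: (b, Zpos xH)] [:: (c, Zpos xH)])).

Definition swap_sign (A : structure_constants) (a b : nat) : Z :=
  sign_of (sc_parity A a && sc_parity A b).

(** The linearized alternative laws, with a sign whenever two odd arguments are exchanged; closure
    of the basis and additivity of parity are tested as well. *)
Definition superalternative (A : structure_constants) : bool :=
  let B := sc_basis A in
  all (fun a => all (fun b => all (fun t =>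
      (t.1 \in B) && (sc_parity A t.1 == sc_parity A a (+) sc_parity A b)) (sc_mul A a b) &&
    all (fun c =>
      vanishing (associator A a b c ++ scale_comb (swap_sign A a b) (associator A b a c)) &&
      vanishing (associator A a b c ++ scale_comb (swap_sign A b c) (associator A a c b))) B) B) B.

(* [(i, a, t)] takes the coordinate at [t] of a monomial in [algebra_of i] whose
   variable [p] has the value [nth 0 a p]. *)
Definition functional : Type := (nat * seq nat * nat)%type.

Definition hletter (a : seq nat) (i : nat) : mask * acomb :=
  (mkseq (fun j => j == i) 6, [:: (nth 0 a i, Zpos xH)]).

Definition hact (A : structure_constants) (a : seq nat) (x : mask * acomb) (g : seq nat) :=
  match g with
  | [:: i] => hcom A x (hletter a i)
  | [:: i; j] => hcom A x (hcom A (hletter a i) (hletter a j))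
  | _ => (x.1, [::])
  end.

Definition full_mask (n : nat) : mask := mkseq (fun i => i <= n) 6.

Definition functional_value (n : nat) (f : functional) (w : word) : Z :=
  let x := foldl (hact (algebra_of f.1.1) f.1.2) (hletter f.1.2 0) w in
  if x.1 == full_mask n then comb_coef f.2 x.2 else Z0.

(* The number in front of a functional is the index of the word for which its row is
   to be solved. *)
Definition functionals2 : seq (positive * functional) := [::
  (3%positive, (1, [:: 0; 2; 3], 7))].

Definition functionals3 : seq (positive * functional) := [::
  (8%positive, (1, [:: 0; 0; 2; 3], 7));
  (10%positive, (1, [:: 0; 2; 0; 3], 7));
  (12%positive, (1, [:: 0; 2; 3; 0], 7));
  (11%positive, (1, [:: 0; 2; 3; 4], 0))].

Definition functionals4 : seq (positive * functional) := [::
  (21%positive, (1, [:: 0; 0; 0; 2; 3], 7));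
  (31%positive, (1, [:: 0; 0; 2; 0; 3], 7));
  (33%positive, (1, [:: 0; 0; 2; 3; 0], 7));
  (36%positive, (1, [:: 0; 0; 2; 3; 4], 0));
  (39%positive, (1, [:: 0; 0; 2; 3; 5], 3));
  (61%positive, (1, [:: 0; 0; 2; 5; 3], 3));
  (46%positive, (1, [:: 0; 0; 2; 5; 6], 6));
  (45%positive, (1, [:: 0; 2; 0; 0; 3], 7));
  (51%positive, (1, [:: 0; 2; 0; 3; 0], 7));
  (49%positive, (1, [:: 0; 2; 0; 3; 4], 0));
  (59%positive, (1, [:: 0; 2; 0; 3; 5], 3));
  (65%positive, (1, [:: 0; 2; 0; 5; 3], 3));
  (54%positive, (1, [:: 0; 2; 0; 5; 6], 6));
  (60%positive, (1, [:: 0; 2; 3; 0; 0], 7));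
  (66%positive, (1, [:: 0; 2; 3; 0; 4], 0));
  (50%positive, (1, [:: 0; 2; 3; 0; 5], 3));
  (47%positive, (1, [:: 0; 2; 3; 2; 4], 2));
  (63%positive, (1, [:: 0; 2; 3; 4; 0], 0));
  (62%positive, (1, [:: 0; 2; 3; 4; 2], 2));
  (64%positive, (1, [:: 0; 2; 3; 4; 5], 5))].

Definition functionals5 : seq (positive * functional) := [::
  (357%positive, (1, [:: 6; 0; 0; 5; 7; 6], 6));
  (405%positive, (1, [:: 5; 2; 3; 4; 0; 0], 5));
  (418%positive, (1, [:: 3; 0; 6; 5; 0; 0], 5));
  (430%positive, (1, [:: 7; 0; 0; 6; 5; 0], 0));
  (367%positive, (2, [:: 1; 0; 0; 1; 0; 0], 16));
  (281%positive, (1, [:: 6; 2; 3; 0; 0; 0], 2));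
  (348%positive, (2, [:: 1; 0; 1; 0; 0; 0], 16));
  (277%positive, (2, [:: 1; 0; 0; 0; 1; 0], 16));
  (214%positive, (1, [:: 0; 2; 4; 0; 0; 0], 6));
  (327%positive, (1, [:: 2; 5; 4; 2; 2; 3], 2));
  (305%positive, (1, [:: 0; 5; 6; 0; 0; 3], 5));
  (448%positive, (1, [:: 7; 0; 0; 0; 4; 3], 3));
  (204%positive, (1, [:: 3; 6; 5; 5; 2; 7], 3));
  (242%positive, (1, [:: 4; 7; 0; 2; 3; 4], 0));
  (382%positive, (2, [:: 0; 0; 1; 0; 0; 1], 16));
  (282%positive, (1, [:: 6; 2; 0; 0; 3; 0], 2));
  (237%positive, (1, [:: 3; 2; 0; 0; 6; 0], 2));
  (247%positive, (1, [:: 3; 6; 0; 0; 5; 7], 3));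
  (339%positive, (1, [:: 4; 7; 0; 5; 0; 0], 5));
  (366%positive, (1, [:: 5; 6; 0; 2; 0; 0], 6));
  (345%positive, (1, [:: 5; 6; 2; 5; 0; 0], 4));
  (429%positive, (1, [:: 3; 0; 0; 4; 0; 0], 5));
  (114%positive, (1, [:: 6; 3; 4; 0; 2; 0], 6));
  (419%positive, (1, [:: 6; 3; 5; 7; 6; 6], 6));
  (428%positive, (1, [:: 5; 6; 0; 2; 3; 3], 3));
  (352%positive, (1, [:: 3; 6; 3; 4; 3; 2], 3));
  (360%positive, (1, [:: 3; 4; 6; 3; 2; 6], 6));
  (341%positive, (2, [:: 1; 0; 0; 0; 0; 1], 16));
  (431%positive, (1, [:: 7; 5; 0; 0; 6; 0], 0));
  (293%positive, (1, [:: 4; 7; 4; 3; 6; 3], 5));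
  (384%positive, (1, [:: 4; 0; 2; 4; 3; 0], 4));
  (422%positive, (1, [:: 4; 2; 0; 0; 5; 7], 0));
  (417%positive, (1, [:: 3; 5; 6; 6; 7; 3], 3));
  (433%positive, (1, [:: 2; 0; 0; 0; 3; 4], 0));
  (368%positive, (1, [:: 0; 7; 0; 0; 6; 5], 0));
  (409%positive, (1, [:: 6; 3; 7; 0; 6; 4], 6));
  (383%positive, (1, [:: 0; 6; 3; 0; 5; 7], 3));
  (372%positive, (1, [:: 0; 0; 6; 0; 5; 7], 0));
  (436%positive, (1, [:: 2; 4; 7; 0; 3; 0], 7));
  (332%positive, (1, [:: 5; 7; 0; 4; 6; 0], 4));
  (421%positive, (1, [:: 7; 6; 3; 0; 4; 3], 3));
  (370%positive, (1, [:: 4; 0; 7; 0; 2; 5], 0));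
  (262%positive, (1, [:: 3; 6; 3; 0; 2; 5], 3));
  (337%positive, (1, [:: 7; 3; 5; 6; 6; 6], 6));
  (350%positive, (1, [:: 2; 3; 6; 0; 0; 0], 2));
  (411%positive, (1, [:: 7; 5; 0; 0; 0; 2], 7));
  (192%positive, (1, [:: 0; 5; 6; 7; 0; 2], 2));
  (371%positive, (1, [:: 4; 2; 0; 3; 0; 5], 5));
  (304%positive, (1, [:: 2; 5; 2; 4; 3; 2], 2));
  (365%positive, (1, [:: 7; 0; 4; 7; 5; 6], 0));
  (420%positive, (1, [:: 3; 5; 6; 3; 2; 2], 7));
  (410%positive, (1, [:: 2; 0; 4; 3; 0; 0], 0));
  (342%positive, (1, [:: 5; 6; 4; 7; 7; 5], 5));
  (434%positive, (1, [:: 4; 3; 4; 4; 7; 7], 5));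
  (294%positive, (1, [:: 0; 4; 3; 0; 2; 0], 0));
  (302%positive, (1, [:: 3; 2; 4; 3; 6; 6], 6));
  (355%positive, (1, [:: 3; 3; 6; 3; 2; 6], 7));
  (445%positive, (1, [:: 2; 0; 4; 6; 3; 3], 0));
  (426%positive, (1, [:: 3; 2; 0; 5; 6; 5], 5));
  (202%positive, (2, [:: 0; 0; 1; 1; 0; 0], 16));
  (447%positive, (1, [:: 5; 2; 2; 3; 4; 4], 4));
  (438%positive, (1, [:: 7; 6; 0; 3; 4; 0], 0));
  (437%positive, (2, [:: 0; 0; 1; 0; 1; 0], 16));
  (216%positive, (2, [:: 0; 1; 1; 0; 0; 0], 16));
  (215%positive, (1, [:: 5; 0; 2; 6; 7; 5], 0));
  (450%positive, (1, [:: 3; 4; 0; 6; 3; 0], 5));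
  (435%positive, (1, [:: 5; 4; 7; 7; 4; 6], 4));
  (349%positive, (2, [:: 0; 1; 0; 1; 0; 0], 16));
  (416%positive, (1, [:: 2; 6; 6; 7; 5; 3], 2));
  (423%positive, (1, [:: 2; 5; 5; 4; 2; 3], 5));
  (446%positive, (1, [:: 4; 0; 3; 4; 0; 2], 4));
  (306%positive, (1, [:: 0; 6; 7; 0; 0; 5], 0));
  (255%positive, (1, [:: 0; 6; 5; 2; 7; 0], 2));
  (427%positive, (1, [:: 5; 6; 2; 3; 3; 6], 0));
  (380%positive, (1, [:: 7; 6; 5; 2; 4; 7], 2));
  (353%positive, (1, [:: 4; 3; 2; 5; 6; 3], 5));
  (432%positive, (1, [:: 5; 4; 5; 2; 2; 3], 5));
  (441%positive, (1, [:: 7; 0; 5; 6; 0; 5], 5));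
  (356%positive, (1, [:: 7; 4; 4; 3; 2; 5], 5));
  (190%positive, (1, [:: 5; 2; 7; 4; 5; 6], 4));
  (369%positive, (1, [:: 5; 7; 2; 4; 4; 3], 5));
  (443%positive, (1, [:: 2; 0; 0; 5; 4; 2], 6));
  (442%positive, (1, [:: 2; 6; 2; 5; 3; 3], 7));
  (412%positive, (1, [:: 6; 7; 0; 3; 0; 6], 2));
  (444%positive, (1, [:: 7; 0; 5; 0; 6; 7], 7));
  (415%positive, (1, [:: 2; 3; 5; 6; 0; 7], 7));
  (351%positive, (1, [:: 2; 2; 3; 5; 5; 6], 0));
  (408%positive, (1, [:: 7; 6; 5; 5; 2; 2], 2));
  (449%positive, (2, [:: 1; 1; 0; 0; 0; 0], 16));
  (188%positive, (2, [:: 0; 0; 0; 0; 1; 1], 16))].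

(* For [e_(i, i+1)] placed along a permutation, the functional is the coefficient of that
   permutation in the associative expansion. *)
Definition matrix_functionals (n : nat) : seq (option positive * functional) :=
  [seq (None, (0, [seq 8 * index i (0 :: p) + 1 | i <- iota 0 n.+1], n.+1)) | p <- permutations (iota 1 n)].

(** The n! matrix functionals and the 1, 4, 20, 90 tabulated ones for n = 2, 3, 4, 5 are exactly as
    many as the remaining words. In the matrix functionals 8j + 1 = 7j + (j + 1) is the code of
    e_(j,j+1), and n + 1 that of e_(0,n+1). *)
Definition functionals (n : nat) : seq (option positive * functional) :=
  matrix_functionals n ++
  [seq (Some kf.1, kf.2) |
     kf <- nth [::] [:: [::]; [::]; functionals2; functionals3; functionals4; functionals5] n].

(** A letter is a single generator times a basis vector; equal parities put it into the envelope. *)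
Definition functional_ok (n : nat) (f : functional) : bool :=
  let A := algebra_of f.1.1 in
  all (fun i => (nth 0 f.1.2 i \in sc_basis A) && (sc_parity A (nth 0 f.1.2 i) == sc_odd A)) (iota 0 n.+1).

Definition letter_words (n : nat) : seq word := words n (iota 1 n).

Definition indexed (n : nat) : seq (positive * word) :=
  let W := letter_words n in zip [seq Pos.of_succ_nat i | i <- iota 0 (size W)] W.

(** The decidable hypotheses of [separation], with functionals evaluated on the non-pivot words
    only. *)
Definition separation_check (n : nat) : bool :=
  let m := pivots n in
  let W := indexed n in
  let bound := Pos.of_succ_nat (size W) in
  let dom k := Pos.ltb k bound in
  let N := [seq iw <- W | ~~ is_pivot m iw.1] in
  all (reduced_at dom m) (unzip1 W) &&
  let g := gauss [seq (kf.1, [seq t <- [seq (iw.1, functional_value n kf.2 iw.2) | iw <- N] | t.2 != Z0])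
     | kf <- functionals n] in
  all (solved_at g) (unzip1 N).

Local Open Scope ring_scope.

(** * Commutators in alternative algebras *)

Definition mcomb := seq (magma * Z).

Definition mmul (r s : mcomb) : mcomb :=
  [seq (MMul t.1 u.1, Z.mul t.2 u.2) | t <- r, u <- s].

Fixpoint commutator_expansion (u : magma) : mcomb :=
  match u with
  | MVar i => [:: (MVar i, Zpos xH)]
  | MMul v w =>
      let r := commutator_expansion v in let s := commutator_expansion w in
      mmul r s ++ rneg (mmul s r)
  end.

Fixpoint code_magma (u : magma) (k : positive) : positive :=
  match u with
  | MVar i => xO (iter i xI (xO k))
  | MMul v w => xI (code_magma v (code_magma w k))
  end.

Definition associator_comb (p q r : magma) : mcomb :=
  [:: (MMul (MMul p q) r, Zpos xH); (MMul p (MMul q r), Zneg xH)].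

Definition left_alternative_comb p q r := associator_comb p q r ++ associator_comb q p r.
Definition right_alternative_comb p q r := associator_comb p q r ++ associator_comb p r q.

(** Up to renaming, the multilinear consequences of a law of degree 3 in degree 4 are spanned by its
    products with a variable and by substitutions of a product for one argument. *)
Definition alternative_consequences (w x y z : magma) : seq mcomb :=
  flatten [seq [:: mmul (alt w x y) [:: (z, Zpos xH)]; mmul [:: (z, Zpos xH)] (alt w x y);
                   alt (MMul w x) y z; alt w (MMul x y) z; alt w x (MMul y z)]
    | alt <- [:: left_alternative_comb; right_alternative_comb]].

Definition degree4_consequences : seq mcomb :=
  flatten [seq let v i := MVar (nth 0 p i) in alternative_consequences (v 0%N) (v 1%N) (v 2%N) (v 3%N)
    | p <- permutations (iota 0 4)].

Definition degree4_monomials : seq magma :=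
  flatten [seq let v i := MVar (nth 0 p i) in
     let a := v 0%N in let b := v 1%N in let c := v 2%N in let d := v 3%N in
     [:: MMul (MMul (MMul a b) c) d; MMul (MMul a (MMul b c)) d; MMul a (MMul (MMul b c) d);
         MMul a (MMul b (MMul c d)); MMul (MMul a b) (MMul c d)]
    | p <- permutations (iota 0 4)].

Definition di_Malcev_comb : mcomb :=
  let a := MVar 0 in let b := MVar 1 in let c := MVar 2 in let d := MVar 3 in
  let e := commutator_expansion in
  e (MMul (MMul (MMul a b) c) d) ++ rneg (e (MMul (MMul (MMul a d) b) c)) ++
  rneg (e (MMul (MMul a (MMul c d)) b)) ++ rneg (e (MMul (MMul a c) (MMul b d))) ++
  rneg (e (MMul a (MMul (MMul b c) d))).

Definition di_Malcev_check : bool :=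
  let t := index_trie (fun u => code_magma u xH) xH degree4_monomials Leaf in
  let int := intern (fun u => code_magma u xH) t in
  let m := gauss [seq (None, r) | r <- pmap int degree4_consequences] in
  if int di_Malcev_comb is Some r then reduce m r == [::] else false.

Lemma di_Malcev_checked : di_Malcev_check. Proof. by vm_compute. Qed.

Section InternSound.
Variables (F : fieldType) (K : eqType) (code : K -> positive) (W : seq K) (k0 : K).
Variables (V : lmodType F) (q : K -> V).

(** Numbering starts at 1, hence the predecessor. *)
Definition lookup (i : positive) : K := nth k0 W (Pos.to_nat i).-1.

Lemma index_trieP i s t c j l : tfind c (index_trie code i s t) = Some (j, l) ->
  tfind c t = Some (j, l) \/
  exists n, [/\ (n < size s)%N, l = nth k0 s n & Pos.to_nat j = (Pos.to_nat i + n)%N].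
Proof.
elim: s i t => [|k s IH] i t /=; first by left.
case/IH => [|[n [ns -> ->]]]; last first.
  by right; exists n.+1; rewrite Pos2Nat.inj_succ addSnnS.
rewrite tfind_tadd; case: eqP => [_ [ij kl]|_ ->]; last by left.
by right; exists 0%N; rewrite addn0 -ij -kl.
Qed.

Lemma intern_sound r s :
  intern code (index_trie code xH W Leaf) r = Some s ->
  lincomb (fun i => q (lookup i)) s = lincomb q r.
Proof.
set t := index_trie _ _ _ _; elim: r s => [|[k a] r IH] s /=.
  by case=> <-; rewrite !lincomb_nil.
case E: (tfind _ _) => [[i l]|] //; case: (intern _ _ _) IH => // s' IH.
case: eqP => // kl [<-]; have {}IH := IH _ (erefl _).
rewrite -[X in lincomb _ X]/(radd [:: (i, a)] s') lincomb_radd IH.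
rewrite lincomb_cons lincomb_nil addr0 lincomb_cons /=.
congr (_ *: q _ + _); case: (index_trieP E) => [|[n [_ E2 ij]]]; first by case: (code k).
by rewrite kl E2 /lookup ij Pos2Nat.inj_1.
Qed.
End InternSound.

Record alternative (F : fieldType) (V : lmodType F) (op : V -> V -> V) : Prop := Alternative {
  alt_bil : bilinear_for *:%R *:%R op;
  alt_left : forall a b c, assoc_l op a b c + assoc_l op b a c = 0;
  alt_right : forall a b c, assoc_l op a b c + assoc_l op a c b = 0 }.

Section CommutatorMalcev.
Variables (F : fieldType) (F2 : (2%:R : F) != 0) (F3 : (3%:R : F) != 0).
Variables (V : lmodType F) (op : V -> V -> V).
Hypothesis alt : alternative op.
Let bil := alt_bil alt.
Local Notation com := (dicommutator op op).

Lemma lincomb_neg (K : Type) (f : K -> V) r : lincomb f (rneg r) = - lincomb f r.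
Proof. by rewrite lincomb_scale -[Zneg xH]/(Z.opp (Zpos xH)) zFN zF1 scaleN1r. Qed.

Section Values.
Variable x : nat -> V.
Local Notation ev := (lincomb (magma_eval op x)).

Lemma lincomb_mmul r s : ev (mmul r s) = op (ev r) (ev s).
Proof.
rewrite /lincomb (bil_suml bil) /mmul big_allpairs_dep; apply: eq_bigr => t _ /=.
rewrite (bil_sumr bil); apply: eq_bigr => u _ /=.
by rewrite (bilZl bil) (bilZr bil) zFM scalerA.
Qed.

Lemma commutator_expansionE u : ev (commutator_expansion u) = magma_eval com x u.
Proof.
elim: u => [i|u IHu v IHv] /=; first exact: lincomb1.
by rewrite lincomb_cat lincomb_neg !lincomb_mmul IHu IHv.
Qed.

Lemma associator_combE p q r :
  ev (associator_comb p q r) = assoc_l op (magma_eval op x p) (magma_eval op x q) (magma_eval op x r).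
Proof.
rewrite !lincomb_cons lincomb_nil addr0 zF1 scale1r /=.
by rewrite -[Zneg xH]/(Z.opp (Zpos xH)) zFN zF1 scaleN1r.
Qed.

Lemma alternative_consequences0 r : r \in degree4_consequences -> ev r = 0.
Proof.
case/flatten_mapP => p _; rewrite [X in r \in X]/=.
move: (MVar (nth _ _ 0)) (MVar (nth _ _ 1)) (MVar (nth _ _ 2)) (MVar (nth _ _ 3)) => w u y z.
have L a b c : ev (left_alternative_comb a b c) = 0.
  by rewrite lincomb_cat !associator_combE (alt_left alt).
have R a b c : ev (right_alternative_comb a b c) = 0.
  by rewrite lincomb_cat !associator_combE (alt_right alt).
by rewrite /alternative_consequences /= !inE => /or4P[|||/or4P[|||/or4P[|||]]] /eqP->;
  rewrite ?lincomb_mmul ?L ?R ?(bil0l bil) ?(bil0r bil).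
Qed.
End Values.

(** For an anticommutative product the di-Malcev identity is Sagle's form of the Malcev identity.
    Its expansion is reduced to 0 modulo the multilinear consequences of the alternative laws in
    degree 4. *)
Lemma commutator_di_Malcev a b c d : di_Malcev com a b c d = 0.
Proof.
pose x := nth 0 [:: a; b; c; d].
transitivity (lincomb (magma_eval op x) di_Malcev_comb).
  rewrite /di_Malcev_comb; have := commutator_expansionE x.
  move: commutator_expansion => e eE; rewrite !lincomb_cat !lincomb_neg !eE.
  by rewrite !addrA.
have := di_Malcev_checked; have := alternative_consequences0 x; rewrite /di_Malcev_check.
move: degree4_consequences degree4_monomials di_Malcev_comb => rs W r0 rs0.
set t := index_trie _ _ _ _; case E: (intern _ _ _) => [r|] //.
move/eqP => R0; rewrite -(intern_sound (MVar 0) (magma_eval op x) E).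
apply: (reduce_nil_kills F2 F3 (@subspace_eq0 _ _) _ R0).
apply: gauss_kills => //; first exact: subspace_eq0.
move=> kr /mapP[s]; rewrite mem_pmap => /mapP[u ud Eu] ->.
by rewrite (intern_sound (MVar 0) (magma_eval op x) (esym Eu)) rs0.
Qed.

Lemma commutator_malcev : malcev_ideal com (fun v => v = 0).
Proof.
have cbil : bilinear_for *:%R *:%R com.
  apply: bilinearI => c u v w; rewrite /dicommutator.
    by rewrite (bilDl bil) (bilDr bil) (bilZl bil) (bilZr bil) scalerBr opprD addrACA.
  by rewrite (bilDl bil) (bilDr bil) (bilZl bil) (bilZr bil) scalerBr opprD addrACA.
split=> //; first exact: subspace_eq0.
- by move=> u v ->; rewrite (bil0l cbil) (bil0r cbil).
- move=> a b c; rewrite -(bilDr cbil).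
  have -> : com b c + com c b = 0 by rewrite /dicommutator -opprB addNr.
  exact: bil0r cbil _.
- exact: commutator_di_Malcev.
Qed.
End CommutatorMalcev.

(** * Grassmann envelopes of alternative superalgebras *)

Section LinearExtension.
Variables (F : fieldType) (K : choiceType).
Local Notation malgF := {malg F[K]}.

Definition mlift (V : lmodType F) (h : K -> V) (f : malgF) : V :=
  \sum_(k <- msupp f) f@_k *: h k.

Section OneModule.
Variable V : lmodType F.
Implicit Types h : K -> V.

Lemma mliftEw h (f : malgF) (d : {fset K}) : (msupp f `<=` d)%fset ->
  mlift h f = \sum_(k <- d) f@_k *: h k.
Proof.
move=> fd; rewrite /mlift (big_fset_incl _ fd) // => k _ /mcoeff_outdom ->.
by rewrite scale0r.
Qed.

Lemma mlift_linear h c (f g : malgF) : mlift h (c *: f + g) = c *: mlift h f + mlift h g.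
Proof.
pose d := (msupp f `|` msupp g)%fset.
rewrite (@mliftEw h f d) ?fsubsetUl // (@mliftEw h g d) ?fsubsetUr //.
rewrite (@mliftEw h _ d); last first.
  apply: fsubset_trans (msuppD_le _ _) _; apply: fsetSU; exact: msuppZ_le.
rewrite scaler_sumr -big_split; apply: eq_bigr => k _ /=.
by rewrite mcoeffD mcoeffZ scalerDl scalerA.
Qed.

Lemma mliftU h k : mlift h << k >> = h k.
Proof.
by rewrite (@mliftEw _ _ _ (@msuppU_le _ _ k 1)) big_seq_fset1 mcoeffUU scale1r.
Qed.

Lemma mliftD h f g : mlift h (f + g) = mlift h f + mlift h g.
Proof. by have := mlift_linear h 1 f g; rewrite !scale1r. Qed.

Lemma mlift0 h : mlift h 0 = 0.
Proof. by rewrite /mlift msupp0 big_nil. Qed.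

Lemma mliftZ h c f : mlift h (c *: f) = c *: mlift h f.
Proof. by have := mlift_linear h c f 0; rewrite mlift0 !addr0. Qed.

Lemma mlift_linearr (h1 h2 : K -> V) c f :
  mlift (fun k => c *: h1 k + h2 k) f = c *: mlift h1 f + mlift h2 f.
Proof.
rewrite /mlift scaler_sumr -big_split; apply: eq_bigr => k _ /=.
by rewrite scalerDr !scalerA mulrC.
Qed.

Lemma eq_mlift (h1 h2 : K -> V) f : h1 =1 h2 -> mlift h1 f = mlift h2 f.
Proof. by move=> h12; apply: eq_bigr => k _; rewrite h12. Qed.
End OneModule.

Lemma mlift_id (f : malgF) : mlift (fun k => << k >>) f = f.
Proof.
rewrite [RHS]monalgE; apply: eq_bigr => k _; apply/malgP => l.
by rewrite mcoeffZ !mcoeffU -[in RHS](mulr1 (f@_k)) mulrnAr.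
Qed.

Lemma linear_mlift (V : lmodType F) (L : malgF -> V) :
  (forall c f g, L (c *: f + g) = c *: L f + L g) ->
  forall f, L f = mlift (fun k => L << k >>) f.
Proof.
move=> linL f; rewrite -[in LHS](mlift_id f) /mlift.
have L0 : L 0 = 0.
  by have := linL 1 0 0; rewrite !scale1r addr0 => /(congr1 (fun u => u - L 0)); rewrite subrr addrK.
elim: (enum_fset _) => [|k r IH]; first by rewrite !big_nil.
by rewrite !big_cons linL IH.
Qed.

Lemma linear_eq0 (V : lmodType F) (L : malgF -> V) :
  (forall c f g, L (c *: f + g) = c *: L f + L g) ->
  (forall k, L << k >> = 0) -> forall f, L f = 0.
Proof.
move=> linL L0 f; rewrite linear_mlift // /mlift big1 // => k _.
by rewrite L0 scaler0.
Qed.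

Definition bilift (V : lmodType F) (p : K -> K -> V) (f g : malgF) : V :=
  mlift (fun k => mlift (p k) g) f.

Lemma biliftU (V : lmodType F) (p : K -> K -> V) k l : bilift p << k >> << l >> = p k l.
Proof. by rewrite /bilift !mliftU. Qed.

Lemma bilift_bilinear (p : K -> K -> malgF) : bilinear_for *:%R *:%R (bilift p).
Proof.
apply: bilinearI => c u v w; first exact: mlift_linear.
rewrite /bilift -mlift_linearr; apply: eq_mlift => k; exact: mlift_linear.
Qed.
End LinearExtension.

Section CombinationLemmas.
Variables (F : fieldType) (V : lmodType F) (q : nat -> V).
Local Notation ev := (lincomb q).

Lemma lincomb_scale_comb c u : ev (scale_comb c u) = zF F c *: ev u.
Proof. exact: lincomb_scale. Qed.

Lemma zF_sign b : zF F (sign_of b) = (-1) ^+ b.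
Proof. by case: b. Qed.

Lemma zF_signM b c : zF F (sign_of b) * zF F (sign_of c) = zF F (sign_of (b (+) c)).
Proof. by rewrite !zF_sign signr_addb. Qed.

Lemma lincomb_insert k a u : ev (insert_comb k a u) = zF F a *: q k + ev u.
Proof.
elim: u => [|[l b] u IH] /=; first by rewrite lincomb_cons.
case: eqP => [<-|_]; last first.
  by rewrite !lincomb_cons IH addrCA.
rewrite lincomb_cons addrA -scalerDl -zFD /=.
case: Z.eqb_spec => [->|_]; first by rewrite zF0 scale0r add0r.
by rewrite lincomb_cons.
Qed.

Lemma lincomb_collect u : ev (collect u) = ev u.
Proof. by elim: u => //= t u IH; rewrite lincomb_insert IH lincomb_cons. Qed.

Lemma comb_coefE k u : zF F (comb_coef k u) = \sum_(t <- u | t.1 == k) zF F t.2.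
Proof.
elim: u => [|[l a] u IH] /=; first by rewrite big_nil.
by rewrite zFD IH big_cons /= eq_sym; case: ifP => _ //; rewrite zF0 add0r.
Qed.

Lemma vanishing_sound u : vanishing u -> ev u = 0.
Proof.
move/allP => u0; rewrite /lincomb.
rewrite (big_group _ (fun t => t.1)); apply: big1_seq => k; rewrite mem_undup => /andP[_ /mapP[t tu ->]].
under eq_bigr => s /eqP-> do [].
by rewrite -scaler_suml -comb_coefE (eqP (u0 _ tu)) zF0 scale0r.
Qed.
End CombinationLemmas.

(** * Supports and signs of Grassmann monomials *)

Section Masks.
Implicit Types S T U : mask.

Lemma size_munion S T : size S = size T -> size (munion S T) = size S.
Proof. by elim: S T => [|s S IH] [|t T] //= [/IH->]. Qed.

Lemma munionC S T : munion S T = munion T S.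
Proof. by elim: S T => [|s S IH] [|t T] //=; rewrite IH orbC. Qed.

Lemma munionA S T U : munion S (munion T U) = munion (munion S T) U.
Proof. by elim: S T U => [|s S IH] [|t T] [|u U] //=; rewrite IH orbA. Qed.

Lemma nth_munion S T i : size S = size T ->
  nth false (munion S T) i = nth false S i || nth false T i.
Proof. by elim: S T i => [|s S IH] [|t T] [|i] //= [/IH]. Qed.

Lemma mdisjointC S T : mdisjoint S T = mdisjoint T S.
Proof. by elim: S T => [|s S IH] [|t T] //=; rewrite IH (andbC s). Qed.

Lemma mdisjointUl S T U : size S = size T -> size T = size U ->
  mdisjoint (munion S T) U = mdisjoint S U && mdisjoint T U.
Proof.
elim: S T U => [|s S IH] [|t T] [|u U] //= [ST] [TU].
by rewrite IH // andb_orl negb_or; case: (s && u); case: (t && u); rewrite /= ?andbF.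
Qed.

Lemma mdisjointUr S T U : size S = size T -> size T = size U ->
  mdisjoint S (munion T U) = mdisjoint S T && mdisjoint S U.
Proof. by move=> ST TU; rewrite mdisjointC mdisjointUl ?(mdisjointC S) // -?TU. Qed.

Lemma nth_mdisjoint S T i : mdisjoint S T -> nth false S i -> nth false T i -> False.
Proof.
elim: S T i => [|s S IH] [|t T] [|i] //= /andP[st ST]; last exact: IH ST.
by move=> si ti; rewrite si ti in st.
Qed.

Lemma odd_munion S T : size S = size T -> mdisjoint S T ->
  odd (count id (munion S T)) = odd (count id S) (+) odd (count id T).
Proof.
elim: S T => [|s S IH] [|t T] //= [ST] /andP[st /(IH _ ST)]; rewrite !oddD => ->.
by move: st; case: s; case: t => //= _; case: (odd (count id S)); case: (odd (count id T)).
Qed.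

Lemma minversionsUl S T U : size S = size T -> size T = size U -> mdisjoint S T ->
  minversions (munion S T) U = minversions S U (+) minversions T U.
Proof.
elim: S T U => [|s S IH] [|t T] [|u U] //= [ST] [TU] /andP[_ dST].
by rewrite IH // odd_munion // addbACA; case: u.
Qed.

Lemma minversionsUr S T U : size S = size T -> size T = size U -> mdisjoint T U ->
  minversions S (munion T U) = minversions S T (+) minversions S U.
Proof.
elim: S T U => [|s S IH] [|t T] [|u U] //= [ST] [TU] /andP[tu dTU].
rewrite IH // addbACA; congr (_ (+) _).
by move: tu; case: t; case: u => //=; rewrite addbF.
Qed.

(** For disjoint S and T every pair of elements is inverted in exactly one of the two orders, so the
    two counts add up to the product of the cardinalities. *)
Lemma minversionsC S T : size S = size T -> mdisjoint S T ->
  minversions T S = minversions S T (+) (odd (count id S) && odd (count id T)).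
Proof.
elim: S T => [|s S IH] [|t T] //= [ST] /andP[st dST]; rewrite IH // !oddD.
move: st; case: s; case: t => //= _; case: (odd (count id S)); case: (odd (count id T));
  by case: (minversions S T).
Qed.
End Masks.

Section Envelope.
Variables (F : fieldType) (A : structure_constants).
Hypothesis altA : superalternative A.

Local Notation K := (seq bool * nat)%type.
Local Notation env := {malg F[K]}.

(** These keys span the envelope: the basis vector is odd exactly when the letters are odd and the
    Grassmann monomial has odd degree. Products with any other key are set to 0, which makes the
    whole free module alternative. *)
Definition valid (k : K) : bool :=
  [&& size k.1 == 6, k.2 \in sc_basis A & sc_parity A k.2 == sc_odd A && odd (count id k.1)].

Definition hom (S : mask) (u : acomb) : env := locked (lincomb (fun b => << (S, b) >> : env) u).

Lemma homE S u : hom S u = lincomb (fun b => << (S, b) >> : env) u.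
Proof. by rewrite /hom -lock. Qed.

Definition basis_mul (k l : K) : env :=
  if [&& valid k, valid l & mdisjoint k.1 l.1] then
    zF F (sign_of (msign A k.1 l.1)) *: hom (munion k.1 l.1) (sc_mul A k.2 l.2)
  else 0.

Definition env_mul (f g : env) : env := locked (bilift basis_mul f g).

Lemma env_mulE f g : env_mul f g = bilift basis_mul f g.
Proof. by rewrite /env_mul -lock. Qed.

Lemma env_mul_bilinear : bilinear_for *:%R *:%R env_mul.
Proof.
have bil := bilift_bilinear basis_mul.
by apply: bilinearI => c u v w; rewrite !env_mulE ?(bilDl bil) ?(bilZl bil) ?(bilDr bil) ?(bilZr bil).
Qed.

Let bil := env_mul_bilinear.

Lemma superalternativeP a b : a \in sc_basis A -> b \in sc_basis A ->
  [/\ forall t, t \in sc_mul A a b -> t.1 \in sc_basis A /\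
        sc_parity A t.1 = sc_parity A a (+) sc_parity A b
    & forall c, c \in sc_basis A ->
      vanishing (associator A a b c ++ scale_comb (swap_sign A a b) (associator A b a c)) /\
      vanishing (associator A a b c ++ scale_comb (swap_sign A b c) (associator A a c b))].
Proof.
move=> aB bB; have /allP/(_ b bB)/andP[/allP H1 /allP H2] := allP altA a aB.
split=> [t /H1/andP[tB /eqP]|c /H2/andP[]] //.
Qed.

Lemma valid_mul S T a b t : valid (S, a) -> valid (T, b) -> mdisjoint S T ->
  t \in sc_mul A a b -> valid (munion S T, t.1).
Proof.
case/and3P => /= /eqP sS aB /eqP pa; case/and3P => /= /eqP sT bB /eqP pb dST tab.
have [/(_ t tab)[tB pt] _] := superalternativeP aB bB.
by rewrite /valid /= size_munion ?sS ?sT // tB pt pa pb odd_munion ?sS ?sT // -andb_addr !eqxx.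
Qed.

Definition hvalid (S : mask) (u : acomb) : bool := all (fun t => valid (S, t.1)) u.

Lemma hvalid_amul S T u v : hvalid S u -> hvalid T v -> mdisjoint S T ->
  hvalid (munion S T) (amul A u v).
Proof.
move=> /allP Su /allP Tv dST; apply/allP => t /flatten_mapP[s su /flatten_mapP[r rv]].
by case/mapP => q qm -> /=; apply: valid_mul qm => //; [apply: (Su s)|apply: (Tv r)].
Qed.

Lemma hom_nil S : hom S [::] = 0. Proof. by rewrite homE lincomb_nil. Qed.

Lemma env_mul_hom S T u v : hvalid S u -> hvalid T v ->
  env_mul (hom S u) (hom T v) =
  if mdisjoint S T then zF F (sign_of (msign A S T)) *: hom (munion S T) (amul A u v) else 0.
Proof.
move=> /allP Su /allP Tv; rewrite (homE S) (homE T) /lincomb (bil_suml bil).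
transitivity (\sum_(s <- u) \sum_(t <- v) zF F s.2 *: (zF F t.2 *: basis_mul (S, s.1) (T, t.1))).
  apply: eq_bigr => s _; rewrite (bil_sumr bil); apply: eq_bigr => t _.
  by rewrite (bilZl bil) (bilZr bil) env_mulE biliftU.
case: ifP => dST; last first.
  by rewrite big1 // => s _; rewrite big1 // => t _; rewrite /basis_mul dST !andbF !scaler0.
transitivity (zF F (sign_of (msign A S T)) *: \sum_(s <- u) \sum_(t <- v)
    hom (munion S T) (scale_comb (Z.mul s.2 t.2) (sc_mul A s.1 t.1))).
  rewrite scaler_sumr; apply: eq_big_seq => s su; rewrite scaler_sumr.
  apply: eq_big_seq => t tv; have vs := Su _ su; have vt := Tv _ tv.
  rewrite /basis_mul vs vt dST.
  by rewrite !homE lincomb_scale_comb zFM !scalerA mulrC mulrA.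
congr (_ *: _); rewrite /amul homE; under eq_bigr => s _ do under eq_bigr => t _ do rewrite homE.
elim: (u) => [|s u' IH] /=; first by rewrite big_nil lincomb_nil.
rewrite big_cons IH lincomb_cat; congr (_ + _).
elim: (v) => [|t v' IH'] /=; first by rewrite big_nil lincomb_nil.
by rewrite big_cons IH' lincomb_cat.
Qed.

Lemma hom1 S a : hom S [:: (a, Zpos xH)] = << (S, a) >>.
Proof. by rewrite homE lincomb1. Qed.

Lemma hvalid1 S a : valid (S, a) -> hvalid S [:: (a, Zpos xH)].
Proof. by move=> va; rewrite /hvalid all_seq1. Qed.

Lemma env_mul_invalid k (f : env) : ~~ valid k ->
  env_mul << k >> f = 0 /\ env_mul f << k >> = 0.
Proof.
move=> vk; split.
  rewrite env_mulE /bilift mliftU /mlift big1 // => l _.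
  by rewrite /basis_mul (negPf vk) scaler0.
rewrite env_mulE /bilift /mlift big1 // => l _; rewrite -/(mlift _ _) mliftU.
by rewrite /basis_mul (negPf vk) /= andbF scaler0.
Qed.

Let triple_sign (S T U : mask) : bool := msign A S T (+) msign A S U (+) msign A T U.

(** The inversions between a union and a third mask add up, so both bracketings carry the same sign
    and the associator of [A] factors out. *)
Lemma env_associator S T U a b c : valid (S, a) -> valid (T, b) -> valid (U, c) ->
  assoc_l env_mul << (S, a) >> << (T, b) >> << (U, c) >> =
  if [&& mdisjoint S T, mdisjoint S U & mdisjoint T U] then
    zF F (sign_of (triple_sign S T U)) *: hom (munion (munion S T) U) (associator A a b c)
  else 0.
Proof.
move=> va vb vc; have /andP[/eqP/= sS _] := va; have /andP[/eqP/= sT _] := vb.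
have /andP[/eqP/= sU _] := vc; have ST : size S = size T by rewrite sS sT.
have TU : size T = size U by rewrite sT sU.
have ha := hvalid1 va; have hb := hvalid1 vb; have hc := hvalid1 vc.
have mulE k l (u v : acomb) : u = [:: (k.2, Zpos xH)] -> v = [:: (l.2, Zpos xH)] ->
    hvalid k.1 u -> hvalid l.1 v -> env_mul << k >> << l >> = if mdisjoint k.1 l.1 then
      zF F (sign_of (msign A k.1 l.1)) *: hom (munion k.1 l.1) (amul A u v) else 0.
  case: k l => [S' k] [T' l] /= -> -> hk hl; rewrite -[RHS](env_mul_hom hk hl).
  exact: (f_equal2 env_mul (esym (hom1 S' k)) (esym (hom1 T' l))).
have -> : assoc_l env_mul << (S, a) >> << (T, b) >> << (U, c) >> =
  env_mul (env_mul << (S, a) >> << (T, b) >>) (hom U [:: (c, Zpos xH)]) -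
  env_mul (hom S [:: (a, Zpos xH)]) (env_mul << (T, b) >> << (U, c) >>).
  by rewrite (hom1 S a) (hom1 U c).
rewrite (mulE (S, a) (T, b) _ _ erefl erefl ha hb) (mulE (T, b) (U, c) _ _ erefl erefl hb hc) /=.
set a1 := [:: (a, _)] in ha *; set b1 := [:: (b, _)] in hb *; set c1 := [:: (c, _)] in hc *.
have -> : env_mul (if mdisjoint S T then zF F (sign_of (msign A S T)) *:
      hom (munion S T) (amul A a1 b1) else 0) (hom U c1) =
    if [&& mdisjoint S T, mdisjoint S U & mdisjoint T U] then
      zF F (sign_of (triple_sign S T U)) *:
        hom (munion (munion S T) U) (amul A (amul A a1 b1) c1) else 0.
  case dST: (mdisjoint S T); last exact: bil0l bil _.
  rewrite (bilZl bil) (env_mul_hom (hvalid_amul ha hb dST) hc) (mdisjointUl ST TU) andTb.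
  case: (_ && _); last by rewrite scaler0.
  rewrite scalerA zF_signM; congr (zF F (sign_of _) *: _).
  rewrite /triple_sign /msign (minversionsUl ST TU dST); case: (sc_odd A) => //=.
  by rewrite addbA.
have -> : env_mul (hom S a1) (if mdisjoint T U then zF F (sign_of (msign A T U)) *:
      hom (munion T U) (amul A b1 c1) else 0) =
    if [&& mdisjoint S T, mdisjoint S U & mdisjoint T U] then
      zF F (sign_of (triple_sign S T U)) *:
        hom (munion (munion S T) U) (amul A a1 (amul A b1 c1)) else 0.
  case dTU: (mdisjoint T U); last by rewrite !andbF; exact: bil0r bil _.
  rewrite (bilZr bil) (env_mul_hom ha (hvalid_amul hb hc dTU)) (mdisjointUr ST TU) andbT.
  case: (_ && _); last by rewrite scaler0.
  rewrite scalerA zF_signM munionA; congr (zF F (sign_of _) *: _).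
  rewrite /triple_sign /msign (minversionsUr ST TU dTU); case: (sc_odd A) => //=.
  by rewrite addbC.
case: [&& _, _ & _]; last by rewrite subr0.
rewrite -scalerBr; congr (_ *: _).
rewrite !homE /associator -/a1 -/b1 -/c1 (lincomb_cat _ (amul A (amul A a1 b1) c1)).
by rewrite lincomb_scale_comb -[Zneg xH]/(Z.opp (Zpos xH)) zFN zF1 scaleN1r.
Qed.

(** It suffices to treat basis elements. Exchanging two arguments changes the sign by the product of
    the parities of their masks, which are the parities of the vectors; this is the sign built into
    superalternativity. *)
Lemma env_alternative : alternative env_mul.
Proof.
have lin3 (L : env -> env -> env -> env) :
    (forall c f g u v, L (c *: f + g) u v = c *: L f u v + L g u v) ->
    (forall c f g u v, L u (c *: f + g) v = c *: L u f v + L u g v) ->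
    (forall c f g u v, L u v (c *: f + g) = c *: L u v f + L u v g) ->
    (forall k l m, valid k -> valid l -> valid m -> L << k >> << l >> << m >> = 0) ->
    (forall k f g, ~~ valid k -> [/\ L << k >> f g = 0, L f << k >> g = 0 & L f g << k >> = 0]) ->
    forall f g h, L f g h = 0.
  move=> L1 L2 L3 L0 Li f g h.
  apply: (linear_eq0 (L := fun f => L f g h)) => [c u v|k]; first exact: L1.
  apply: (linear_eq0 (L := fun g => L << k >> g h)) => [c u v|l]; first exact: L2.
  apply: (linear_eq0 (L := fun h => L << k >> << l >> h)) => [c u v|m]; first exact: L3.
  have [vk|nk] := boolP (valid k); last by case: (Li _ << l >> << m >> nk).
  have [vl|nl] := boolP (valid l); last by case: (Li _ << k >> << m >> nl).
  have [vm|nm] := boolP (valid m); last by case: (Li _ << k >> << l >> nm).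
  exact: L0.
have addZ (c : F) (a b d e : env) : c *: a + b + (c *: d + e) = c *: (a + d) + (b + e).
  by rewrite addrACA scalerDr.
have subZ' (c : F) (a b d e : env) : c *: a + b - (c *: d + e) = c *: (a - d) + (b - e).
  by rewrite opprD addrACA scalerBr.
have as1 c f g u v : assoc_l env_mul (c *: f + g) u v = c *: assoc_l env_mul f u v + assoc_l env_mul g u v.
  by rewrite /assoc_l !(bilDl bil, bilZl bil) subZ'.
have as2 c f g u v : assoc_l env_mul u (c *: f + g) v = c *: assoc_l env_mul u f v + assoc_l env_mul u g v.
  by rewrite /assoc_l !(bilDl bil, bilZl bil, bilDr bil, bilZr bil) subZ'.
have as3 c f g u v : assoc_l env_mul u v (c *: f + g) = c *: assoc_l env_mul u v f + assoc_l env_mul u v g.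
  by rewrite /assoc_l !(bilDr bil, bilZr bil) subZ'.
have asi k f g : ~~ valid k -> [/\ assoc_l env_mul << k >> f g = 0,
    assoc_l env_mul f << k >> g = 0 & assoc_l env_mul f g << k >> = 0].
  move=> vk; have inv h := env_mul_invalid h vk.
  by rewrite /assoc_l !(proj1 (inv _)) !(proj2 (inv _)) (bil0l bil) (bil0r bil) !subr0.
split=> // a b c.
  apply: (lin3 (fun a b c => assoc_l env_mul a b c + assoc_l env_mul b a c)) => {a b c}.
  - by move=> c f g u v; rewrite as1 as2 addZ.
  - by move=> c f g u v; rewrite as1 as2 addZ.
  - by move=> c f g u v; rewrite !as3 addZ.
  - move=> [S a] [T b] [U c] va vb vc; rewrite !env_associator //.
    have /and3P[/eqP/= sS aB /eqP/= pa] := va; have /and3P[/eqP/= sT bB /eqP/= pb] := vb.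
    have /and3P[_ /= cB _] := vc; have ST : size S = size T by rewrite sS sT.
    rewrite (mdisjointC T S) [mdisjoint T U && _]andbC.
    case dST: (mdisjoint S T) => //=; last by rewrite addr0.
    case: (_ && _); last by rewrite addr0.
    rewrite (munionC T S) /triple_sign [msign A T S]/msign (minversionsC ST dST).
    have -> : sc_odd A && (minversions S T (+) odd (count id S) && odd (count id T)) =
      msign A S T (+) (sc_parity A a && sc_parity A b).
      by rewrite pa pb /msign; case: (sc_odd A).
    have -> : msign A S T (+) (sc_parity A a && sc_parity A b) (+) msign A T U (+) msign A S U =
      msign A S T (+) msign A S U (+) msign A T U (+) (sc_parity A a && sc_parity A b).
      by case: (msign A S T); case: (msign A S U); case: (msign A T U); case: (_ && _).
    rewrite -(zF_signM F (msign A S T (+) msign A S U (+) msign A T U)) -scalerA -scalerDr.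
    set W := munion _ _.
    have -> : hom W (associator A a b c) + zF F (sign_of (sc_parity A a && sc_parity A b)) *:
       hom W (associator A b a c) = 0; last by rewrite scaler0.
    have [_ /(_ c cB)[van _]] := superalternativeP aB bB.
    rewrite -[RHS](vanishing_sound (fun b => << (W, b) >> : env) van).
    by rewrite !homE (lincomb_cat _ (associator A a b c)) lincomb_scale_comb.
  - move=> k f g nk; have [E1 E2 E3] := asi k f g nk; have [_ _ E6] := asi k g f nk.
    by rewrite E1 E2 E3 E6 !addr0.
apply: (lin3 (fun a b c => assoc_l env_mul a b c + assoc_l env_mul a c b)) => {a b c}.
- by move=> c f g u v; rewrite !as1 addZ.
- by move=> c f g u v; rewrite as2 as3 addZ.
- by move=> c f g u v; rewrite as2 as3 addZ.
- move=> [S a] [T b] [U c] va vb vc; rewrite !env_associator //.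
  have /and3P[/eqP/= sS aB _] := va; have /and3P[/eqP/= sT bB /eqP/= pb] := vb.
  have /and3P[/eqP/= sU cB /eqP/= pc] := vc; have TU : size T = size U by rewrite sT sU.
  rewrite (mdisjointC U T).
  case dTU: (mdisjoint T U) => /=; last by rewrite !andbF addr0.
  rewrite !andbT [mdisjoint S U && _]andbC; case: (_ && _); last by rewrite addr0.
  rewrite -!munionA (munionC U T) munionA /triple_sign [msign A U T]/msign (minversionsC TU dTU).
  have -> : sc_odd A && (minversions T U (+) odd (count id T) && odd (count id U)) =
    msign A T U (+) (sc_parity A b && sc_parity A c).
    by rewrite pb pc /msign; case: (sc_odd A).
  have -> : msign A S U (+) msign A S T (+) (msign A T U (+) (sc_parity A b && sc_parity A c)) =
    msign A S T (+) msign A S U (+) msign A T U (+) (sc_parity A b && sc_parity A c).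
    by case: (msign A S T); case: (msign A S U); case: (msign A T U); case: (_ && _).
  rewrite -(zF_signM F (msign A S T (+) msign A S U (+) msign A T U)) -scalerA -scalerDr.
  set W := munion _ _.
  have -> : hom W (associator A a b c) + zF F (sign_of (sc_parity A b && sc_parity A c)) *:
     hom W (associator A a c b) = 0; last by rewrite scaler0.
  have [_ /(_ c cB)[_ van]] := superalternativeP aB bB.
  rewrite -[RHS](vanishing_sound (fun b => << (W, b) >> : env) van).
  by rewrite !homE (lincomb_cat _ (associator A a b c)) lincomb_scale_comb.
move=> k f g nk; have [E1 E2 E3] := asi k f g nk; have [E4 _ _] := asi k g f nk.
by rewrite E1 E2 E3 E4 !addr0.
Qed.
End Envelope.

Fixpoint leaves (u : magma) : seq nat :=
  match u with MVar i => [:: i] | MMul v w => leaves v ++ leaves w end.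

Lemma size_leaves u : size (leaves u) = magma_size u.
Proof. by elim: u => //= u IHu v IHv; rewrite size_cat IHu IHv. Qed.

Lemma leaves_head u : leaves u = head_leaf u :: behead (leaves u).
Proof. by elim: u => //= u -> v _. Qed.

(** * Values of monomials and words in an envelope *)

Section CombinationValues.
Variables (F : fieldType) (A : structure_constants).
Hypothesis altA : superalternative A.

Local Notation K := (seq bool * nat)%type.
Local Notation mul := (@env_mul F A).
Local Notation com := (dicommutator mul mul).

Definition hval (x : mask * acomb) : {malg F[K]} := hom F x.1 x.2.
Definition hwf (x : mask * acomb) : bool := (size x.1 == 6) && hvalid A x.1 x.2.

Lemma mem_insert_comb k a u t : t \in insert_comb k a u -> t.1 = k \/ t.1 \in unzip1 u.
Proof.
elim: u => [|[l b] u IH] /=; first by rewrite inE => /eqP->; left.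
case: eqP => [->|_].
  case: ifP => _ tu; first by right; rewrite inE map_f ?orbT.
  by move: tu; rewrite inE => /orP[/eqP->|tu]; [left|right; rewrite inE map_f ?orbT].
rewrite inE => /orP[/eqP->|/IH[->|tu]]; [right|left|right] => //; rewrite inE ?eqxx //=.
by rewrite tu orbT.
Qed.

Lemma hvalid_collect S u : hvalid A S u -> hvalid A S (collect u).
Proof.
elim: u => //= s u IH /andP[vs /IH/allP vu]; apply/allP => t /mem_insert_comb[->//|].
by case/mapP => r /vu + ->.
Qed.

Lemma hvalid_scale S c u : hvalid A S u -> hvalid A S (scale_comb c u).
Proof. by move=> vu; rewrite /hvalid all_map. Qed.

Lemma hwf_hcom x y : hwf x -> hwf y -> hwf (hcom A x y).
Proof.
case: x y => [S u] [T v] /andP[/eqP/= sS vu] /andP[/eqP/= sT vv]; rewrite /hwf /hcom /=.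
rewrite size_munion ?sS ?sT //=; case: ifP => // dST; apply: hvalid_collect.
rewrite /hvalid all_cat; apply/andP; split; apply: hvalid_scale; first exact: hvalid_amul.
by rewrite munionC; apply: hvalid_amul; rewrite // mdisjointC.
Qed.

Lemma hval_hcom x y : hwf x -> hwf y -> hval (hcom A x y) = com (hval x) (hval y).
Proof.
case: x y => [S u] [T v] /andP[/eqP/= sS vu] /andP[/eqP/= sT vv].
apply: etrans (esym (f_equal2 (fun a b => a - b) (env_mul_hom F vu vv) (env_mul_hom F vv vu))).
rewrite (mdisjointC T S) (munionC T S) /hval /hcom [LHS]/=.
case: (mdisjoint S T); last by rewrite hom_nil subr0.
rewrite homE lincomb_collect lincomb_cat !lincomb_scale_comb -!homE -scaleNr !zF_sign.
by rewrite signrN.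
Qed.
Lemma mcoeff_hval x T t :
  (hval x)@_(T, t) = if x.1 == T then zF F (comb_coef t x.2) else 0.
Proof.
rewrite /hval homE /lincomb raddf_sum comb_coefE /=.
rewrite (eq_bigr (fun s => if (x.1 == T) && (s.1 == t) then zF F s.2 else 0)) => [|s _].
  by case: eqP => [_|_] /=; [rewrite -big_mkcond|rewrite big1].
rewrite mcoeffZ mcoeffU xpair_eqE; case: (_ && _); first by rewrite mulr1.
by rewrite mulr0.
Qed.

Section Letters.
Variables (n : nat) (a : seq nat).
Hypotheses (n_le5 : (n <= 5)%N)
  (a_ok : all (fun i => (nth 0 a i \in sc_basis A) &&
                        (sc_parity A (nth 0 a i) == sc_odd A)) (iota 0 n.+1)).

Definition letter_value (i : nat) := hval (hletter a i).

Lemma hwf_letter i : (i <= n)%N -> hwf (hletter a i).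
Proof.
move=> i_n; have /(allP a_ok)/andP[iB /eqP pi] : i \in iota 0 n.+1 by rewrite mem_iota.
rewrite /hwf /hvalid /= /valid /= iB pi andbT /=.
have: (i < 6)%N by lia.
by case: i {i_n iB pi} => [|[|[|[|[|[|]]]]]] //= _; rewrite andbT.
Qed.

Local Notation hev := (magma_eval (hcom A) (hletter a)).

Lemma hwf_eval w : all (leq^~ n) (leaves w) -> hwf (hev w).
Proof.
elim: w => [i|u IHu v IHv] /=; first by rewrite andbT; apply: hwf_letter.
by rewrite all_cat => /andP[/IHu + /IHv]; apply: hwf_hcom.
Qed.

Lemma hval_eval w : all (leq^~ n) (leaves w) ->
  hval (hev w) = magma_eval com letter_value w.
Proof.
elim: w => [i|u IHu v IHv] //=; rewrite all_cat => /andP[un vn].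
exact: etrans (hval_hcom (hwf_eval un) (hwf_eval vn)) (f_equal2 _ (IHu un) (IHv vn)).
Qed.

Lemma nth_mask_eval w j : all (leq^~ n) (leaves w) ->
  nth false (hev w).1 j = (j \in leaves w).
Proof.
elim: w => [i|u IHu v IHv] /=.
  rewrite andbT inE => i_n; case: (ltnP j 6) => [j6|j6]; first by rewrite nth_mkseq.
  by rewrite nth_default ?size_mkseq //; case: eqP => // ji; lia.
rewrite all_cat => /andP[un vn]; have /andP[/eqP su _] := hwf_eval un.
have /andP[/eqP sv _] := hwf_eval vn.
by rewrite nth_munion ?su // IHu // IHv // mem_cat.
Qed.

Lemma uniq_leaves_eval w : all (leq^~ n) (leaves w) ->
  (hev w).2 != [::] -> uniq (leaves w).
Proof.
elim: w => [i|u IHu v IHv] //=; rewrite all_cat => /andP[un vn].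
have amul0 x : amul A x [::] = [::] by elim: x.
case: ifP => // duv; case: (eqVneq (hev u).2 [::]) => [->|/(IHu un) uu]; first by rewrite amul0.
case: (eqVneq (hev v).2 [::]) => [->|/(IHv vn) uv]; first by rewrite amul0.
move=> _; rewrite cat_uniq uu uv andbT; apply/hasPn => j jv; apply/negP => ju.
by apply: (@nth_mdisjoint (hev u).1 (hev v).1 j duv); rewrite nth_mask_eval.
Qed.

(** The mask of a value is the set of variables of the monomial, and a repeated variable makes two
    masks meet and the value vanish. So only multilinear monomials reach the full mask. *)
Lemma full_coefficient0 w t : all (leq^~ n) (leaves w) ->
  ~~ perm_eq (leaves w) (iota 0 n.+1) -> (magma_eval com letter_value w)@_(full_mask n, t) = 0.
Proof.
move=> wn; rewrite -hval_eval // mcoeff_hval => nw; case: eqP => // full.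
case: (eqVneq (hev w).2 [::]) => [->|/(uniq_leaves_eval wn) uw]; first exact: zF0.
case/negP: nw; apply: uniq_perm; rewrite ?iota_uniq // => j; rewrite mem_iota /= add0n ltnS.
apply/idP/idP => [/(allP wn)//|j_n].
by rewrite -nth_mask_eval // full nth_mkseq // ltnS (leq_trans j_n).
Qed.

Local Notation hacts := (foldl (hact A a)).

Lemma hact_value x g : hwf x -> all (leq^~ n) g ->
  hwf (hact A a x g) /\ hval (hact A a x g) = act com letter_value (hval x) g.
Proof.
move=> xw; have bad : hwf (x.1, [::]) /\ hval (x.1, [::]) = 0 :> {malg F[K]}.
  by case/andP: xw => sx _; rewrite /hwf sx /hval hom_nil.
case: g => [|i [|j [|k g]]]; [by []| | |by []].
  case/andP => i_n _; have wi := hwf_letter i_n; split; first exact: hwf_hcom.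
  exact: hval_hcom.
case/and3P => i_n j_n _; have [wi wj] := (hwf_letter i_n, hwf_letter j_n).
have wij := hwf_hcom wi wj; split; first exact: hwf_hcom.
exact: etrans (hval_hcom xw wij) (f_equal2 _ erefl (hval_hcom wi wj)).
Qed.

Lemma hacts_value x w : hwf x -> all (leq^~ n) (flatten w) ->
  hval (hacts x w) = acts com letter_value (hval x) w.
Proof.
elim: w x => //= g w IH x xw; rewrite all_cat => /andP[gn wn].
by have [gw E] := hact_value xw gn; rewrite (IH _ gw wn) E.
Qed.
End Letters.
End CombinationValues.

Lemma functional_valueE (F : fieldType) (n : nat) (f : functional) (w : word) :
  (n <= 5)%N -> functional_ok n f -> superalternative (algebra_of f.1.1) ->
  all (leq^~ n) (flatten w) ->
  let e := letter_value F f.1.2 in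
  let mul := @env_mul F (algebra_of f.1.1) in
  zF F (functional_value n f w) = (acts (dicommutator mul mul) e (e 0%N) w)@_(full_mask n, f.2).
Proof.
move=> n5 f_ok alt wn e mul.
have e0 : hwf (algebra_of f.1.1) (hletter f.1.2 0%N) := hwf_letter alt n5 f_ok (leq0n n).
rewrite -(hacts_value F alt n5 f_ok e0 wn).
by rewrite mcoeff_hval /functional_value; case: ifP => _; rewrite ?zF0.
Qed.

(** * Multilinear identities *)

Definition canonical (g : seq nat) : bool :=
  match g with [:: _] => true | [:: a; b] => (a <= b)%N | _ => false end.

Definition words_on (s : seq nat) (l : seq (word * Z)) : bool :=
  all (fun t => perm_eq (flatten t.1) s && all canonical t.1) l.

Lemma words_on_wmul s s' l m : words_on s l -> words_on s' m -> words_on (s ++ s') (wmul l m).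
Proof.
move=> /allP ls /allP ms; apply/allP => _ /allpairsP[[t u] [/ls/andP[ts tc] /ms/andP[us uc] ->]] /=.
by rewrite flatten_cat perm_cat // all_cat tc uc.
Qed.

Lemma words_on_rneg s l : words_on s l -> words_on s (rneg l).
Proof. by move=> ls; rewrite /words_on all_map. Qed.

Lemma words_on_cat s l m : words_on s l -> words_on s m -> words_on s (l ++ m).
Proof. by move=> ls ms; rewrite /words_on all_cat; apply/andP. Qed.

Lemma words_on_perm s s' l : perm_eq s s' -> words_on s l -> words_on s' l.
Proof.
by move=> ss' /allP ls; apply/allP => t /ls/andP[ts ->]; rewrite (perm_trans ts ss').
Qed.

Lemma Rexp_words n u : words_on (leaves u) (Rexp n u).
Proof.
elim: n u => [|n IH] u //=.
have main b c d : words_on ((leaves b ++ leaves c) ++ leaves d)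
    (wmul (Rexp n b) (wmul (Rexp n c) (Rexp n d)) ++
     rneg (wmul (Rexp n d) (wmul (Rexp n b) (Rexp n c))) ++
     rneg (wmul (Rexp n (MMul c d)) (Rexp n b)) ++ rneg (wmul (Rexp n c) (Rexp n (MMul b d)))).
  do ?[apply: words_on_cat]; do ?[apply: words_on_rneg].
  - apply: words_on_perm (words_on_wmul (IH b) (words_on_wmul (IH c) (IH d))).
    by rewrite catA.
  - apply: words_on_perm (words_on_wmul (IH d) (words_on_wmul (IH b) (IH c))).
    by rewrite perm_catC.
  - apply: words_on_perm (words_on_wmul (IH (MMul c d)) (IH b)).
    by rewrite /= perm_catC catA.
  - apply: words_on_perm (words_on_wmul (IH c) (IH (MMul b d))).
    by apply/permP => p; rewrite /= !count_cat; lia.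
case: u => [a|[a|b c] d]; [by rewrite /words_on /= perm_refl| |exact: main].
case: d => [b|c d] /=.
  case: ltnP => ab; rewrite /words_on /= ?ab ?(ltnW ab) !andbT; first exact: perm_refl.
  by rewrite -[[:: b; a]]/([:: b] ++ [:: a]) perm_catC.
apply: words_on_rneg; apply: words_on_perm (main c d (MVar a)).
by rewrite perm_catC.
Qed.

Lemma spine_words w : words_on (behead (leaves w)) (spine w).
Proof.
elim: w => [//|u IHu v _] /=.
have -> : behead (leaves u ++ leaves v) = behead (leaves u) ++ leaves v by rewrite leaves_head.
by apply: words_on_wmul => //; apply: Rexp_words.
Qed.

Lemma wordsS n s : s != [::] -> words n.+1 s = flatten [seq
    [seq [:: a] :: w | w <- words n (rem a s)] ++
    flatten [seq [seq [:: a; b] :: w | w <- words n (rem a (rem b s))] | b <- s & (a < b)%N]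
  | a <- s].
Proof. by case: s. Qed.

Lemma mem_words n s w : (size s <= n)%N -> uniq s -> perm_eq (flatten w) s ->
  all canonical w -> w \in words n s.
Proof.
have nilw v : perm_eq (flatten v) [::] -> all canonical v -> v = [::].
  by case: v => [|[|a g] v] //= /perm_nilP.
elim: n s w => [|n IH] s w; first by case: s => // _ _ /nilw H /H ->.
have [->|s_nz] := eqVneq s [::]; first by move=> _ _ /nilw H /H ->.
rewrite wordsS // => sn us; case: w => [|g w] /=.
  by move/perm_size => /esym/eqP; rewrite size_eq0 (negPf s_nz).
move=> gs /andP[cg cw]; apply/flatten_mapP.
have rest (a : nat) t v : uniq t -> perm_eq (a :: v) t ->
    [/\ a \in t, uniq (rem a t), size (rem a t) = (size t).-1
    & perm_eq v (rem a t)].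
  move=> ut P; have at_ : a \in t by rewrite -(perm_mem P) mem_head.
  rewrite rem_uniq // size_rem //; split=> //.
  by rewrite -(perm_cons a); apply: perm_trans P (perm_to_rem at_).
have sn' : ((size s).-1 <= n)%N by rewrite -ltnS prednK // lt0n size_eq0.
case: g cg gs => [|a [|b [|c g]]] //= ab gs; have [as_ ua sa Pa] := rest _ _ _ us gs.
  by exists a => //; rewrite mem_cat map_f // IH // sa.
have [bs ub sb Pb] := rest _ _ _ ua Pa; exists a => //; rewrite mem_cat; apply/orP; right.
have bs' : b \in s by apply: mem_rem bs.
(* The letters are distinct, so the weak inequality in [canonical] is strict here. *)
have ba : (a < b)%N.
  by rewrite ltn_neqAle ab andbT; apply/eqP => E1; move: bs; rewrite -E1 mem_rem_uniq ?inE ?eqxx.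
have remC : rem b (rem a s) = rem a (rem b s).
  rewrite !rem_filter ?filter_uniq // -!filter_predI; by apply: eq_filter => z /=; rewrite andbC.
apply/flatten_mapP; exists b; first by rewrite mem_filter ba.
by rewrite map_f // -remC IH // sb sa (leq_trans (leq_pred _)).
Qed.

Lemma words_sub n s w : w \in words n s -> {subset flatten w <= s}.
Proof.
elim: n s w => [|n IH] s w; first by case: s => // /[!inE] /eqP->.
have [->|s_nz] := eqVneq s [::]; first by rewrite inE => /eqP->.
rewrite wordsS // => /flatten_mapP[a as_]; rewrite mem_cat => /orP[/mapP[v vw ->]|].
  by move=> z; rewrite /= inE => /orP[/eqP->//|/(IH _ _ vw)/mem_rem].
case/flatten_mapP => b; rewrite mem_filter => /andP[_ bs] /mapP[v vw ->] z.
by rewrite /= !inE => /or3P[/eqP->//|/eqP->//|/(IH _ _ vw)/mem_rem/mem_rem].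
Qed.

Lemma relation_in_context n r : r \in relations n ->
  exists l b c d m, r = in_context l (swap_relation b c d) m.
Proof.
case/flatten_mapP => k _ /flatten_mapP[s _ /flatten_mapP[[w1 w2] _]].
move: (words 6 _) (words 6 _) => ls ms.
case/allpairsP => -[t [l m]] [/= tc _ ->].
case/flatten_mapP: tc => s1 _ /flatten_mapP[s2 _ /mapP[b _ ->]].
by exists l, b, (MVar (head 0%N s2.1)), (MVar (head 0%N s2.2)), m.
Qed.

Section Kills.
Variables (F : fieldType) (F2 : (2%:R : F) != 0) (F3 : (3%:R : F) != 0).
Variables (V : lmodType F) (op : V -> V -> V) (I : V -> Prop) (mi : malcev_ideal op I).
Variable x : nat -> V.

Lemma pivots_kill n :
  kills I (fun i => acts op x (x 0%N) (lookup (letter_words n) [::] i)) (pivots n).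
Proof.
have sI := mi_sub mi.
apply: gauss_kills => // kr /mapP[r]; rewrite /relation_rows mem_pmap => /mapP[rel rel_in /esym E] -> /=.
rewrite (intern_sound [::] (acts op x (x 0%N)) E) -/(evw op x (x 0%N) rel).
have [l [b [c [d [m ->]]]]] := relation_in_context rel_in.
rewrite (evw_in_context mi); apply: acts_ideal => //; exact: swap_relation_kills.
Qed.

Lemma eval_spine w : head_leaf w = 0%N ->
  I (magma_eval op x w - evw op x (x 0%N) (spine w)).
Proof. by move=> <-; apply: spine_sound. Qed.
End Kills.

Lemma superalternative_algebra i : superalternative (algebra_of i).
Proof. by case: i => [|[|i]]; vm_compute. Qed.

Lemma functionals_ok : all (fun n => all (fun kf => functional_ok n kf.2) (functionals n)) (iota 0 6).
Proof. by vm_compute. Qed.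

(** The linear algebra for degrees 1 to 6. It is carried out over the integers with pivots 2^a 3^b,
    so a single computation serves all fields of characteristic other than 2 and 3. *)
Lemma separation_checked : all separation_check (iota 0 6).
Proof. vm_cast_no_check (erefl true). Qed.

Section Separation.
Variables (F : fieldType) (n : nat).
Hypotheses (F2 : (2%:R : F) != 0) (F3 : (3%:R : F) != 0) (n_le5 : (n <= 5)%N).

Let W := letter_words n.
Let position (w : word) : positive := Pos.of_succ_nat (index w W).

Lemma unzip1_indexed : unzip1 (indexed n) = [seq Pos.of_succ_nat i | i <- iota 0 (size W)].
Proof. by rewrite unzip1_zip // size_map size_iota. Qed.

Lemma lookup_indexed iw : iw \in indexed n -> lookup W [::] iw.1 = iw.2.
Proof.
case/(nthP (xH, [::])) => i; rewrite size_zip size_map size_iota minnn => iW <-.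
rewrite /indexed nth_zip ?size_map ?size_iota //= (nth_map 0%N) ?size_iota // nth_iota //.
by rewrite /lookup SuccNat2Pos.id_succ.
Qed.

Lemma lookup_position w : w \in W -> lookup W [::] (position w) = w.
Proof. by move=> wW; rewrite /lookup /position SuccNat2Pos.id_succ nth_index. Qed.

Lemma position_indexed w : w \in W -> position w \in unzip1 (indexed n).
Proof. by move=> wW; rewrite unzip1_indexed /position map_f // mem_iota /= index_mem. Qed.

Lemma uniq_indexed : uniq (unzip1 (indexed n)).
Proof.
rewrite unzip1_indexed map_inj_uniq ?iota_uniq // => i j.
exact: SuccNat2Pos.inj.
Qed.

Lemma sub_indexed : {subset (fun k => Pos.ltb k (Pos.of_succ_nat (size (indexed n)))) <= unzip1 (indexed n)}.
Proof.
move=> k; rewrite unfold_in size_zip size_map size_iota minnn => /Pos.ltb_spec0 kW.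
have kE : k = Pos.of_succ_nat (Pos.to_nat k).-1.
  by apply: Pos2Nat.inj; rewrite SuccNat2Pos.id_succ prednK //; apply/ltP/Pos2Nat.is_pos.
rewrite unzip1_indexed kE map_f // mem_iota /= add0n.
move/Pos2Nat.inj_lt/ltP: kW; rewrite SuccNat2Pos.id_succ; have /ltP := Pos2Nat.is_pos k.
by case: (Pos.to_nat k).
Qed.

Local Notation com A := (dicommutator (@env_mul F A) (@env_mul F A)).

Definition multilinear (w : magma) : bool :=
  (head_leaf w == 0%N) && perm_eq (leaves w) (iota 0 n.+1).

Lemma multilinear_spine w t : multilinear w -> t \in spine w -> t.1 \in W.
Proof.
case/andP => /eqP h0; rewrite leaves_head h0 /= perm_cons => P tw.
have /(allP (spine_words w))/andP[Pt ct] := tw.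
apply: mem_words ct; rewrite ?size_iota ?iota_uniq //; exact: perm_trans Pt P.
Qed.

Lemma multilinear_separation (r : seq (F * magma)) :
  all (fun t => multilinear t.2) r ->
  (forall kf, kf \in functionals n ->
     (\sum_(t <- r) t.1 *:
        magma_eval (com (algebra_of kf.2.1.1)) (letter_value F kf.2.1.2) t.2)@_(full_mask n, kf.2.2) = 0) ->
  forall (V : lmodType F) (op : V -> V -> V) (I : V -> Prop) (x : nat -> V),
  malcev_ideal op I -> I (\sum_(t <- r) t.1 *: magma_eval op x t.2).
Proof.
move=> /allP mr f0 V op I x mi.
(* The expansion of [r] into words depends on no algebra; by [toT] it is valid modulo any Malcev
   ideal. *)
pose T := [seq (t.1 * zF F s.2, s.1) | t <- r, s <- spine t.2].
have TW u : u \in T -> u.2 \in W.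
  by case/allpairsPdep => t [s [/mr mt st ->]]; apply: multilinear_spine st.
have toT (V' : lmodType F) (op' : V' -> V' -> V') I' (x' : nat -> V') : malcev_ideal op' I' ->
    I' (\sum_(t <- r) t.1 *: magma_eval op' x' t.2 - \sum_(u <- T) u.1 *: acts op' x' (x' 0%N) u.2).
  move=> mi'; have sI' := mi_sub mi'.
  rewrite /T big_allpairs_dep /= -sumrB; apply: sub_sum => // t tr _.
  under eq_bigr => s _ do rewrite -scalerA.
  rewrite -scaler_sumr -scalerBr; apply: subZ => //.
  by apply: eval_spine => //; case/andP: (mr _ tr) => /eqP.
pose c i : F := \sum_(u <- T | position u.2 == i) u.1.
have byT (V' : lmodType F) (q : word -> V') :
    \sum_(i <- unzip1 (indexed n)) c i *: q (lookup W [::] i) = \sum_(u <- T) u.1 *: q u.2.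
  under eq_bigr => i _ do rewrite /c scaler_suml.
  rewrite (exchange_big_dep xpredT) //= big_seq [RHS]big_seq; apply: eq_bigr => u uT.
  have uW := TW u uT; rewrite (big_rem (position u.2)) ?position_indexed //= eqxx.
  rewrite lookup_position // big_seq_cond big1 ?addr0 // => i /andP[+ /eqP E].
  by rewrite -E mem_rem_uniqF ?uniq_indexed.
have n6 : n \in iota 0 6 by rewrite mem_iota.
have fok := allP functionals_ok n n6.
have /andP[red slv] := allP separation_checked n n6.
pose val (f : functional) i := functional_value n f (lookup W [::] i).
have WE w : w \in W -> all (leq^~ n) (flatten w).
  by move/words_sub => sw; apply/allP => i /sw; rewrite mem_iota add1n ltnS => /andP[].
(* Any index may occur in a row; beyond the list [lookup] gives the empty word. *)
have lookupE i : all (leq^~ n) (flatten (lookup W [::] i)).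
  rewrite /lookup; case: (ltnP (Pos.to_nat i).-1 (size W)) => iW; last by rewrite nth_default.
  by apply/WE/mem_nth.
have comM A : superalternative A -> malcev_ideal (com A) (fun v => v = 0).
  by move=> /(env_alternative F); apply: commutator_malcev.
have sI := mi_sub mi.
apply: (cong_sub sI (toT _ _ _ _ mi)).
rewrite -byT; pose m := pivots n; pose N := [seq w <- unzip1 (indexed n) | ~~ is_pivot m w].
have slvN : all (solved_at (gauss [seq (kf.1, [seq t <- [seq (b, val kf.2 b) | b <- N] | t.2 != Z0])
    | kf <- functionals n])) N.
  rewrite /N filter_map; move: slv; congr (all (solved_at (gauss _)) _).
  apply: eq_map => kf; congr (_, filter _ _); rewrite -map_comp; apply/eq_in_map => iw /=.
  by rewrite mem_filter /val => /andP[_ /lookup_indexed ->].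
have valE kf i : kf \in functionals n ->
    zF F (val kf.2 i) = (acts (com (algebra_of kf.2.1.1)) (letter_value F kf.2.1.2)
      (letter_value F kf.2.1.2 0%N) (lookup W [::] i))@_(full_mask n, kf.2.2).
  move=> kfn; have alt := superalternative_algebra kf.2.1.1.
  exact: (functional_valueE F n_le5 (allP fok _ kfn) alt (lookupE i)).
have valK kf : kf \in functionals n -> kills (fun v => v = 0) (fun i => zF F (val kf.2 i) : F^o) m.
  move=> kfn k q Ek; have := pivots_kill F2 F3 (comM _ (superalternative_algebra kf.2.1.1))
    (letter_value F kf.2.1.2) Ek.
  move/(congr1 (mcoeff (full_mask n, kf.2.2))); rewrite mcoeff0 /lincomb raddf_sum => E.
  rewrite -[RHS]E; apply: eq_bigr => t _; rewrite valE //.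
  exact: esym (mcoeffZ _ _ _).
have cJ kf : kf \in functionals n -> \sum_(i <- unzip1 (indexed n)) c i * zF F (val kf.2 i) = 0.
  move=> kfn; set e := letter_value F kf.2.1.2; set mul := com (algebra_of kf.2.1.1).
  pose q w : F^o := (acts mul e (e 0%N) w)@_(full_mask n, kf.2.2).
  transitivity (\sum_(i <- unzip1 (indexed n)) c i *: q (lookup W [::] i)).
    by apply: eq_bigr => i _; rewrite valE.
  (* For the zero ideal of the commutator algebra [toT] is an equality. *)
  have := toT _ _ _ e (comM _ (superalternative_algebra kf.2.1.1)); rewrite byT => /eqP.
  rewrite subr_eq0 => /eqP E; rewrite -[RHS](f0 kf kfn) E raddf_sum.
  by apply: eq_bigr => u _; exact: esym (mcoeffZ _ _ _).
exact: (separation F2 F3 uniq_indexed sub_indexed red slvN valK cJ sI (@pivots_kill _ F2 F3 _ _ _ mi x n)).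
Qed.
End Separation.

(** * Polarization *)

Section FreeAlgebra.
Variable F : fieldType.
Local Notation NA := (freeNA F).
Local Notation "f ** g" := (@NAmul F f g) (at level 40, left associativity).

Lemma malgUZ (K : choiceType) (c : F) (k : K) : << c *g k >> = c *: << k >> :> {malg F[K]}.
Proof. by apply/malgP => l; rewrite mcoeffZ !mcoeffU mulr_natr. Qed.

Lemma NAmulE f g : f ** g = bilift (fun u v => << MMul u v >> : NA) f g.
Proof.
rewrite /NAmul /bilift; apply: eq_bigr => u _; rewrite scaler_sumr.
by apply: eq_bigr => v _; rewrite malgUZ scalerA.
Qed.

Lemma NAmul_bilinear : bilinear_for *:%R *:%R (@NAmul F).
Proof.
have bil := bilift_bilinear (fun u v => << MMul u v >> : NA).
by apply: bilinearI => c u v w; rewrite !NAmulE ?(bilDl bil) ?(bilZl bil) ?(bilDr bil) ?(bilZr bil).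
Qed.

Lemma NAmulU u v : << u >> ** << v >> = << MMul u v >>.
Proof. by rewrite NAmulE biliftU. Qed.

Lemma NAendo_eval (v : nat -> NA) : NAendo (mlift (magma_eval (@NAmul F) v)).
Proof.
have bil := NAmul_bilinear; split=> [c f g|f g]; first exact: mlift_linear.
set phi := mlift _; apply/eqP; rewrite -subr_eq0; apply/eqP.
have phiL c a b : phi (c *: a + b) = c *: phi a + phi b by apply: mlift_linear.
have subL (c : F) (a b d e : NA) : c *: a + b - (c *: d + e) = c *: (a - d) + (b - e).
  by rewrite opprD addrACA scalerBr.
apply: (linear_eq0 (L := fun f => phi (f ** g) - phi f ** phi g)) => [c a b|k].
  by rewrite phiL (bilDl bil) (bilZl bil) phiL (bilDl bil) (bilZl bil) subL.
apply: (linear_eq0 (L := fun g => phi (<< k >> ** g) - phi << k >> ** phi g)) => [c a b|l].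
  by rewrite phiL (bilDr bil) (bilZr bil) phiL (bilDr bil) (bilZr bil) subL.
by rewrite NAmulU /phi !mliftU /= subrr.
Qed.

Lemma Tideal_malcev (I : NA -> Prop) : Tideal I ->
  (forall g, Malcev_dialgebra_identities g -> I g) -> malcev_ideal (@NAmul F) I.
Proof.
case=> I0 Ilin Imul Iendo Imal.
have subst v : exists phi : NA -> NA, [/\ {morph phi : f g / f + g}, {morph phi : f / - f},
    {morph phi : f g / f ** g}, forall i, phi (NAvar F i) = v i & forall f, I f -> I (phi f)].
  exists (mlift (magma_eval (@NAmul F) v)); have E := NAendo_eval v; split; last exact: Iendo.
  - exact: mliftD.
  - by move=> f; rewrite -[- f]scaleN1r mliftZ scaleN1r.
  - by case: E.
  - by move=> i; apply: mliftU.
split=> //; first exact: NAmul_bilinear.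
- move=> a b c; have [phi [phiD _ phiM phiV /(_ _ (Imal _ (or_introl erefl)))]] :=
    subst (nth 0 [:: a; b; c]).
  rewrite /right_anticommutativity; move: (@NAmul F) (NAvar F) phiM phiV => M X phiM phiV.
  by rewrite phiD !phiM !phiV.
- move=> a b c d; have [phi [phiD phiN phiM phiV /(_ _ (Imal _ (or_intror erefl)))]] :=
    subst (nth 0 [:: a; b; c; d]).
  rewrite /di_Malcev_identity; move: (@NAmul F) (NAvar F) phiM phiV => M X phiM phiV.
  by rewrite !phiD !phiN !phiM !phiV.
Qed.
End FreeAlgebra.

(* The second component of a dicommutator monomial is the commutator monomial
   whose leftmost variable takes its value in the second summand. *)
Section Double.
Variables (F : fieldType) (E : lmodType F) (op : E -> E -> E).
Hypothesis alt : alternative op.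
Let bil := alt_bil alt.

Definition double_l (x y : E * E) : E * E := (op x.1 y.1, op x.2 y.1).
Definition double_r (x y : E * E) : E * E := (op x.1 y.1, op x.1 y.2).

Lemma double_alternative_dialgebra : alternative_dialgebra double_l double_r.
Proof.
have altl a b c : assoc_l op a b c = - assoc_l op b a c.
  by apply/eqP; rewrite -addr_eq0 (alt_left alt).
have altr a b c : assoc_l op a b c = - assoc_l op a c b.
  by apply/eqP; rewrite -addr_eq0 (alt_right alt).
have rev_assoc a b c : assoc_l op a b c + assoc_l op c b a = 0.
  by rewrite altl altr altl opprK addNr.
have rot_assoc a b c : assoc_l op a b c - assoc_l op b c a = 0.
  by rewrite altl altr opprK subrr.
split; first split.
- split; apply: bilinearI => c [u1 u2] [v1 v2] [w1 w2]; congr (_, _) => /=;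
    by rewrite ?(bilDl bil) ?(bilZl bil) ?(bilDr bil) ?(bilZr bil).
- by [].
- by [].
- move=> [a a'] [b b'] [c c']; exact: (f_equal2 pair (rev_assoc a b c) (rev_assoc a' b c)).
- move=> [a a'] [b b'] [c c']; exact: (f_equal2 pair (rot_assoc a b c) (rot_assoc a' b c)).
- move=> [a a'] [b b'] [c c'].
  exact: (f_equal2 pair (alt_right alt a b c) (alt_right alt a b' c)).
Qed.
End Double.

(** * Polarization by labelling leaves with positions *)

Section Labelings.
Variable P : nat -> seq nat.

Fixpoint labelings (s : seq nat) : seq (seq nat) :=
  if s is i :: s' then [seq p :: q | p <- P i, q <- labelings s'] else [:: [::]].

(** The monomials arising when sums are substituted for the variables of [u]; as in the second
    summand of the double, [Q] concerns the leftmost leaf alone. *)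
Fixpoint expansions (Q : nat -> seq nat) (u : magma) : seq magma :=
  match u with
  | MVar i => map MVar (Q i)
  | MMul v w => [seq MMul a b | a <- expansions Q v, b <- expansions P w]
  end.

Lemma allpairs_cons_cat (r : seq nat) (A B : seq (seq nat)) :
  [seq x ++ y | x <- [seq p :: q | p <- r, q <- A], y <- B] =
  [seq p :: q | p <- r, q <- [seq x ++ y | x <- A, y <- B]].
Proof.
elim: r => //= p r IH; rewrite map_cat flatten_cat IH map_allpairs; congr (_ ++ _).
by rewrite allpairs_mapl.
Qed.

Lemma labelings_cat s t :
  labelings (s ++ t) = [seq x ++ y | x <- labelings s, y <- labelings t].
Proof.
elim: s => [|i s IH] /=; first by rewrite cats0 map_id.
by rewrite IH allpairs_cons_cat.
Qed.

Lemma leaves_expansions Q u : map leaves (expansions Q u) =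
  [seq p :: q | p <- Q (head_leaf u), q <- labelings (behead (leaves u))].
Proof.
elim: u Q => [i|u IHu v IHv] Q /=.
  by elim: (Q i) => //= p r ->.
rewrite map_allpairs.
have -> : behead (leaves u ++ leaves v) = behead (leaves u) ++ leaves v by rewrite leaves_head.
rewrite labelings_cat -allpairs_cons_cat -IHu.
have -> : labelings (leaves v) = map leaves (expansions P v) by rewrite IHv leaves_head.
by rewrite allpairs_mapl allpairs_mapr.
Qed.

Lemma expansionsP (k : nat -> nat) Q u w :
  (forall i p, p \in P i -> k p = i) -> (forall i p, p \in Q i -> k p = i) ->
  w \in expansions Q u -> magma_eval MMul (fun p => MVar (k p)) w = u.
Proof.
move=> kP; elim: u Q w => [i|u IHu v IHv] Q w kQ /=.
  by case/mapP => p /kQ ki ->; rewrite /= ki.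
by case/allpairsP => -[a b] [/= au bv ->] /=; rewrite (IHu Q) // (IHv P).
Qed.

Section Evaluation.
Variables (F : fieldType) (E : lmodType F) (op : E -> E -> E).
Hypothesis bil : bilinear_for *:%R *:%R op.
Local Notation com := (dicommutator op op).
Variables (Q : nat -> seq nat) (e : nat -> E).

Lemma dicommutator_suml (T : Type) (r : seq T) (f : T -> E) b :
  com (\sum_(t <- r) f t) b = \sum_(t <- r) com (f t) b.
Proof. by rewrite /dicommutator (bil_suml bil) (bil_sumr bil) -sumrB. Qed.

Lemma dicommutator_sumr (T : Type) (r : seq T) (f : T -> E) a :
  com a (\sum_(t <- r) f t) = \sum_(t <- r) com a (f t).
Proof. by rewrite /dicommutator (bil_suml bil) (bil_sumr bil) -sumrB. Qed.

Lemma eval_double u :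
  magma_eval (dicommutator (double_l op) (double_r op))
    (fun i => (\sum_(p <- P i) e p, \sum_(p <- Q i) e p)) u =
  (\sum_(w <- expansions P u) magma_eval com e w,
   \sum_(w <- expansions Q u) magma_eval com e w).
Proof.
have E0 R i : \sum_(w <- [seq MVar p | p <- R i]) magma_eval com e w = \sum_(p <- R i) e p.
  by rewrite big_map.
have E2 R v w : \sum_(t <- expansions R (MMul v w)) magma_eval com e t =
    com (\sum_(t <- expansions R v) magma_eval com e t) (\sum_(t <- expansions P w) magma_eval com e t).
  rewrite /= big_allpairs_dep dicommutator_suml; apply: eq_bigr => a _.
  by rewrite dicommutator_sumr.
elim: u => [i|u IHu v IHv]; first by rewrite /= !E0.
by rewrite [LHS]/= IHu IHv !E2.
Qed.
End Evaluation.
End Labelings.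

(** For t = s this is the order of the stabilizer of s, the product of the factorials of the
    multiplicities. Positions start at 1 because 0 is reserved for the leftmost leaf. *)
Definition arrangements (s t : seq nat) : nat :=
  count (fun q => [seq nth 0%N s i.-1 | i <- q] == t) (permutations (iota 1 (size s))).

Lemma map_nth_perm_inj (r a b : seq nat) : perm_eq r (iota 0 (size a)) -> size b = size a ->
  [seq nth 0%N a i | i <- r] = [seq nth 0%N b i | i <- r] -> a = b.
Proof.
move=> Pr sab /eq_in_map H; apply: (@eq_from_nth _ 0%N) => // i ia.
by apply: H; rewrite (perm_mem Pr) mem_iota.
Qed.

Lemma map_shift_iota (s : seq nat) : [seq nth 0%N s i.-1 | i <- iota 1 (size s)] = s.
Proof. by rewrite -[1%N]addn0 iotaDl -map_comp -[RHS](mkseq_nth 0%N). Qed.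

Lemma arrangements_perm s t q : perm_eq q (iota 1 (size s)) ->
  [seq nth 0%N s i.-1 | i <- q] = t -> perm_eq t s.
Proof. by move=> Pq <-; rewrite -{2}(map_shift_iota s) perm_map. Qed.

Lemma arrangements0 s t : ~~ perm_eq t s -> arrangements s t = 0%N.
Proof.
move=> nst; apply/eqP; rewrite -leqn0 leqNgt -has_count; apply/hasPn => q.
rewrite mem_permutations => Pq; apply/eqP => E; case/negP: nst.
exact: arrangements_perm E.
Qed.

(** The permutations carrying s to t form a coset of the stabilizer: composition with a fixed
    rearrangement [r] of s into t is a bijection between the two sets counted. *)
Lemma arrangements_eq s t : perm_eq t s -> arrangements s t = arrangements s s.
Proof.
move=> ts; have /(perm_iotaP 0%N) [r Pr tE] := ts.
set n := size s in Pr; pose sh q := [seq nth 0%N q i | i <- r].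
have szr : size r = n by rewrite (perm_size Pr) size_iota.
have shP q : perm_eq q (iota 1 n) -> perm_eq (sh q) (iota 1 n).
  move=> Pq; apply: (perm_trans _ Pq); rewrite /sh -{2}(mkseq_nth 0%N q).
  by rewrite (perm_size Pq) size_iota perm_map.
have pm : perm_eq (map sh (permutations (iota 1 n))) (permutations (iota 1 n)).
  have inj : {in permutations (iota 1 n) &, injective sh}.
    move=> a b; rewrite !mem_permutations => /perm_size + /perm_size.
    rewrite size_iota => sa sb; apply: map_nth_perm_inj; by rewrite ?sa.
  have U : uniq (map sh (permutations (iota 1 n))).
    by rewrite map_inj_in_uniq ?permutations_uniq.
  have sub : {subset map sh (permutations (iota 1 n)) <= permutations (iota 1 n)}.
    by move=> _ /mapP[q + ->]; rewrite !mem_permutations; apply: shP.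
  have [_ E] := uniq_min_size U sub (eq_leq (esym (size_map _ _))).
  by apply: uniq_perm; rewrite ?permutations_uniq.
rewrite /arrangements -/n -(permP pm) count_map; apply: eq_in_count => q.
rewrite mem_permutations => Pq /=; have sq : size q = n by rewrite (perm_size Pq) size_iota.
have -> : [seq nth 0%N s i.-1 | i <- sh q] = [seq nth 0%N [seq nth 0%N s i.-1 | i <- q] i | i <- r].
  rewrite -map_comp; apply/eq_in_map => i; rewrite (perm_mem Pr) mem_iota => /andP[_ ir] /=.
  by rewrite (nth_map 0%N) ?sq.
apply/eqP/eqP => [|-> //]; rewrite {1}tE => H; apply/esym.
by apply: (map_nth_perm_inj Pr); rewrite ?size_map.
Qed.

Fixpoint bounded_lists (n : nat) : seq (seq nat) :=
  if n is n'.+1 then [seq rcons l i | l <- bounded_lists n', i <- iota 0 n] else [:: [::]].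

Lemma mem_bounded_lists s : (forall i, (i < size s)%N -> (nth 0%N s i <= i)%N) ->
  s \in bounded_lists (size s).
Proof.
elim/last_ind: s => // s x IH H; rewrite size_rcons; apply: allpairs_f.
  apply: IH => i si; have := H i; rewrite size_rcons nth_rcons si; apply; exact: ltnW.
by have := H (size s); rewrite size_rcons nth_rcons ltnn eqxx mem_iota => /(_ (ltnSn _)).
Qed.

(** With two distinct entries among at most five, the product of the factorials of the
    multiplicities divides 4!; five equal entries would give 120. *)
Lemma arrangements_checked : all (fun n =>
  all (fun t => constant t || (arrangements t t %| 24)%N) (bounded_lists n)) (iota 0 6).
Proof. vm_cast_no_check (erefl true). Qed.

(** Renaming each entry to the position of its first occurrence keeps the stabilizer and bounds the
    entries, which leaves finitely many lists to check. *)
Definition pattern (s : seq nat) : seq nat := [seq index x s | x <- s].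

Lemma arrangements_pattern s : arrangements (pattern s) (pattern s) = arrangements s s.
Proof.
rewrite /arrangements size_map; apply: eq_in_count => q; rewrite mem_permutations => Pq.
have -> : [seq nth 0%N (pattern s) i.-1 | i <- q] = [seq index x s | x <- [seq nth 0%N s i.-1 | i <- q]].
  rewrite -map_comp; apply/eq_in_map => i; rewrite (perm_mem Pq) mem_iota add1n ltnS => iq /=.
  by rewrite (nth_map 0%N) //; case: (i) iq.
have indexK L : {subset L <= s} -> map (nth 0%N s) [seq index x s | x <- L] = L.
  by move=> Ls; rewrite -map_comp map_id_in // => x /Ls xs /=; rewrite nth_index.
apply/eqP/eqP => [/(congr1 (map (nth 0%N s)))|-> //]; rewrite !indexK // => x.
case/mapP => i; rewrite (perm_mem Pq) mem_iota add1n ltnS => iq ->; apply: mem_nth; by case: (i) iq.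
Qed.

Lemma constant_pattern s : constant (pattern s) -> constant s.
Proof.
case: s => //= x s; rewrite eqxx all_map => /allP H; apply/allP => y ys /=.
by have := H y ys; rewrite /=; case: (x =P y) => [<-|].
Qed.

Lemma arrangements_dvd24 s : (size s <= 5)%N -> ~~ constant s -> (arrangements s s %| 24)%N.
Proof.
move=> s5 nc; have sz : size (pattern s) = size s by rewrite size_map.
have /(allP arrangements_checked)/allP/(_ (pattern s)) : size s \in iota 0 6 by rewrite mem_iota.
rewrite arrangements_pattern; case/(_ _)/orP => // [|c].
  rewrite -sz; apply: mem_bounded_lists => i; rewrite sz => si.
  by rewrite (nth_map 0%N) // -ltnS index_ltn // (take_nth 0%N si) mem_rcons mem_head.
by case/negP: nc; apply: constant_pattern.
Qed.

Section Counting.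
Variables (h : nat) (s : seq nat).
Let n := size s.
Let key_at p := nth 0%N (h :: s) p.

Definition tail_positions (i : nat) : seq nat := [seq p <- iota 1 n | key_at p == i].
Definition head_positions (i : nat) : seq nat := [seq p <- [:: 0%N] | key_at p == i].

Lemma mem_labelings t q : (q \in labelings tail_positions t) =
  all (fun p => p \in iota 1 n) q && (map key_at q == t).
Proof.
elim: t q => [|i t IH] [|p q] //=.
- by rewrite inE andbF.
- by apply/allpairsP => -[[a b] [_ _ //]].
- rewrite eqseq_cons; apply/allpairsP/idP.
    by case=> -[a b] [/= + + [-> ->]]; rewrite mem_filter IH => /andP[-> ->] /andP[-> ->].
  case/andP => /andP[pn qn] /andP[pi qt]; exists (p, q); split=> //=; first by rewrite mem_filter pi.
  by rewrite IH qn.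
Qed.

Lemma uniq_labelings t : uniq (labelings tail_positions t).
Proof.
elim: t => //= i t IH; apply: allpairs_uniq => //; first by rewrite filter_uniq ?iota_uniq.
by move=> [a b] [c d] _ _ [-> ->].
Qed.

Lemma count_labelings t :
  count (fun q => perm_eq q (iota 1 n)) (labelings tail_positions t) = arrangements s t.
Proof.
rewrite /arrangements -!size_filter; apply: perm_size; apply: uniq_perm.
- by rewrite filter_uniq ?uniq_labelings.
- by rewrite filter_uniq ?permutations_uniq.
move=> q; rewrite !mem_filter mem_labelings mem_permutations andbC.
case Pq: (perm_eq _ _); rewrite ?andbF // !andbT.
have -> : all (fun p => p \in iota 1 n) q by apply/allP => p; rewrite (perm_mem Pq).
congr (_ == t); apply/eq_in_map => p; rewrite (perm_mem Pq) mem_iota => /andP[p0 _].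
by rewrite /key_at; case: p p0.
Qed.

Lemma head_expansions u w : w \in expansions tail_positions head_positions u ->
  [/\ head_leaf w = 0%N, all (leq^~ n) (leaves w) & head_leaf u = h].
Proof.
move=> wu; have : leaves w \in map leaves (expansions tail_positions head_positions u) by apply: map_f.
rewrite leaves_expansions => /allpairsP[[p q] [/= + + E]].
rewrite mem_filter inE mem_labelings => /andP[/eqP kp /eqP p0] /andP[/allP qn _].
move: E; rewrite leaves_head => -[-> ->]; split; rewrite ?p0 //=; last by rewrite -kp p0.
by apply/allP => i /qn; rewrite mem_iota => /andP[_]; lia.
Qed.

(** All monomials of the given type have the same number of multilinear expansions, and all others
    have none. So polarization followed by restitution multiplies the component of this type by a
    constant and removes the rest. *)
Lemma count_expansions u :
  count (fun w => perm_eq (leaves w) (iota 0 n.+1)) (expansions tail_positions head_positions u) =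
  if (head_leaf u == h) && perm_eq (behead (leaves u)) s then arrangements s s else 0%N.
Proof.
rewrite -(count_map leaves (fun l => perm_eq l (iota 0 n.+1))) leaves_expansions.
rewrite /head_positions /= /key_at /= eq_sym; case: eqP => _ //=; rewrite cats0.
rewrite count_map (eq_count (a2 := fun q => perm_eq q (iota 1 n))) => [|q]; last exact: perm_cons.
rewrite count_labelings; case: ifP => [/arrangements_eq //|/negbT]; exact: arrangements0.
Qed.
End Counting.

Lemma NA_eval_relabel (F : fieldType) (k : nat -> nat) (w : magma) :
  magma_eval (@NAmul F) (fun p => NAvar F (k p)) w = << magma_eval MMul (fun p => MVar (k p)) w >>.
Proof. by elim: w => //= u -> v ->; rewrite NAmulU. Qed.

Section Components.
Variables (F : fieldType).
Hypotheses (F2 : (2%:R : F) != 0) (F3 : (3%:R : F) != 0).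
Variables (f : freeNA F) (f_id : dicommutator_identity f).
Variables (I : freeNA F -> Prop) (mi : malcev_ideal (@NAmul F) I).
Let sI := mi_sub mi.

Definition has_type (h : nat) (s : seq nat) (u : magma) : bool :=
  (head_leaf u == h) && perm_eq (behead (leaves u)) s.

Lemma mixed_component h s : (size s <= 5)%N -> ~~ constant s ->
  I (\sum_(u <- msupp f | has_type h s u) f@_u *: << u >>).
Proof.
move=> s5 nc; set n := size s in s5; pose P := tail_positions h s; pose Q := head_positions h s.
pose ex u := [seq w <- expansions P Q u | perm_eq (leaves w) (iota 0 n.+1)].
pose r := [seq (f@_u, w) | u <- msupp f, w <- ex u].
have mr : all (fun t => multilinear n t.2) r.
  apply/allP => _ /allpairsPdep[u [w [_ + ->]]]; rewrite mem_filter /multilinear /= => /andP[-> wu].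
  by have [-> _ _] := head_expansions wu.
have f0 kf : kf \in functionals n ->
   (\sum_(t <- r) t.1 *: magma_eval
      (dicommutator (@env_mul F (algebra_of kf.2.1.1)) (@env_mul F (algebra_of kf.2.1.1)))
      (letter_value F kf.2.1.2) t.2)@_(full_mask n, kf.2.2) = 0.
  move=> kfn; have alt := superalternative_algebra kf.2.1.1.
  have ok : functional_ok n kf.2.
    by apply: (allP (allP functionals_ok n _)) kfn; rewrite mem_iota.
  have ealt := env_alternative F alt; set mul := @env_mul _ _ in ealt *.
  set e := letter_value F kf.2.1.2; set ev := magma_eval (dicommutator mul mul) e.
  (* A variable takes the sum of the letters at its tail positions in the first summand, and in the
     second the letter 0 if it is [h]. *)
  have := f_id (double_alternative_dialgebra ealt)
    (fun i => (\sum_(p <- P i) e p, \sum_(p <- Q i) e p)).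
  rewrite /NAeval; under eq_bigr => u _ do rewrite (eval_double P (alt_bil ealt) Q e).
  move/(congr1 snd); rewrite (big_morph snd (id1 := 0) (op1 := +%R)) //= => E.
  have {}E := congr1 (mcoeff (full_mask n, kf.2.2)) E; rewrite mcoeff0 in E.
  rewrite -[RHS]E /r big_allpairs_dep /=.
  rewrite !raddf_sum; apply: eq_bigr => u _; rewrite -scaler_sumr.
  apply: etrans (mcoeffZ _ _ _) (etrans _ (esym (mcoeffZ _ _ _))); congr (_ * _).
  (* The expansions that are not multilinear do not reach the full mask. *)
  rewrite !raddf_sum /ex big_filter /= [RHS](bigID (fun w => perm_eq (leaves w) (iota 0 n.+1))) /=.
  rewrite [X in _ = _ + X]big_seq_cond [X in _ = _ + X]big1 ?addr0 // => w /andP[wu nw].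
  have [_ wn _] := head_expansions wu; exact: (full_coefficient0 F alt s5 ok _ wn nw).
(* Restitution: each position is sent to the variable standing there, so every expansion of [u]
   becomes [u] again. *)
have := multilinear_separation F2 F3 s5 mr f0 (fun p => NAvar F (nth 0%N (h :: s) p)) mi.
have -> : \sum_(t <- r) t.1 *: magma_eval (@NAmul F) (fun p => NAvar F (nth 0%N (h :: s) p)) t.2 =
    (arrangements s s)%:R *: \sum_(u <- msupp f | has_type h s u) f@_u *: << u >>.
  rewrite /r big_allpairs_dep /= scaler_sumr [RHS]big_mkcond; apply: eq_bigr => u _.
  transitivity (\sum_(w <- ex u) f@_u *: (<< u >> : freeNA F)).
    apply: eq_big_seq => w; rewrite mem_filter NA_eval_relabel => /andP[_ wu]; congr (_ *: << _ >>).
    by apply: (expansionsP _ _ wu) => i p; rewrite mem_filter => /andP[/eqP].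
  rewrite big_const_seq count_predT /ex size_filter count_expansions /has_type -/n.
  by case: ifP => _; rewrite -/(iterop _ _ _ _) ?iter_addr_0 ?scaler_nat.
have a0 : (arrangements s s)%:R != 0 :> F.
  have /dvdnP[q E] := arrangements_dvd24 s5 nc; apply/eqP => a0.
  have : (2 * 2 * 2 * 3)%:R = 0 :> F by rewrite -[(2 * 2 * 2 * 3)%N]/24%N E natrM a0 mulr0.
  by move/eqP; rewrite !natrM !mulf_eq0 !(negPf F2) (negPf F3).
move/(subZ sI (arrangements s s)%:R^-1); by rewrite scalerA mulVf // scale1r.
Qed.
End Components.

(** * Monomials with a single variable to the right of the leftmost one *)

Definition left_normed (h x n : nat) : magma := iter n (fun u => MMul u (MVar x)) (MVar h).

Lemma magma_size1 u : (magma_size u <= 1)%N -> exists i, u = MVar i.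
Proof.
case: u => [i _|v w] /=; first by exists i.
by have := magma_size_gt0 v; have := magma_size_gt0 w; lia.
Qed.

Lemma MMul_eq u v u' v' : (MMul u v == MMul u' v') = (u == u') && (v == v').
Proof. by apply/eqP/andP => [[-> ->]|[/eqP-> /eqP->]]. Qed.

Lemma MVar_eq i j : (MVar i == MVar j) = (i == j).
Proof. by apply/eqP/eqP => [[]|->]. Qed.

Lemma left_normedS h x n : left_normed h x n.+1 = MMul (left_normed h x n) (MVar x).
Proof. by []. Qed.

Section PolynomialDialgebra.
Variable F : fieldType.
Local Notation D := ({poly F} * {poly F})%type.

Definition poly_l (a b : D) : D := (a.1 * b.1, a.2 * b.1).
Definition poly_r (a b : D) : D := (a.1 * b.1, 0).

Lemma poly_alternative_dialgebra : alternative_dialgebra poly_l poly_r.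
Proof.
have al a b c : assoc_l poly_l a b c = 0.
  by congr (_, _); rewrite /= mulrA subrr.
have ar a b c : assoc_r poly_r a b c = 0.
  by congr (_, _); rewrite /= ?mulrA subrr.
have ax a b c : assoc_x poly_l poly_r a b c = 0.
  by congr (_, _); rewrite /= ?mulrA ?mul0r subrr.
split; [|by move=> a b c; rewrite ?al ?ar ?ax ?subr0 ?addr0..].
split; [split|by move=> a b c|by move=> a b c].
  by apply: bilinearI => c u v w; congr (_, _); rewrite /= ?mulrDl ?mulrDr -?scalerAl -?scalerAr.
apply: bilinearI => c u v w; congr (_, _) => /=;
  by rewrite ?mulrDl ?mulrDr -?scalerAl -?scalerAr ?scaler0 ?addr0.
Qed.

Variables h x : nat.
Let v (i : nat) : D := (if i == x then 'X else 0, if i == h then 1 else 0).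
Let ev := magma_eval (dicommutator poly_l poly_r) v.

(** The dicommutator of a and b is (0, a.2 * b.1), because first components commute. A right factor
    that is itself a product therefore gives 0, and only left-normed monomials survive. *)
Lemma poly_eval u :
  (ev u).1 = (if u is MVar i then if i == x then 'X else 0 else 0) /\
  (ev u).2 = (if u == left_normed h x (magma_size u).-1 then 'X^((magma_size u).-1) else 0).
Proof.
elim: u => [i|u [IH1 IH2] w [IH3 _]]; first by rewrite /= MVar_eq expr0.
split; first by rewrite /= [_ * _]mulrC subrr.
have -> : (ev (MMul u w)).2 = (ev u).2 * (ev w).1 by rewrite /= subr0.
rewrite IH2 IH3 {IH1 IH2 IH3} /=; have u0 := magma_size_gt0 u; case: w => [i|w1 w2].
  rewrite addn1 /= -{3 4}(prednK u0) left_normedS MMul_eq MVar_eq exprSr.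
  by case: (u == _) (i == x) => [] [] //=; rewrite ?mul0r ?mulr0.
rewrite mulr0; case: (_.-1) => [|m]; first by case: eqP.
by rewrite left_normedS MMul_eq andbC; case: eqP.
Qed.

(** The powers of the indeterminate separate the degrees over any field, and no factorial
    appears. *)
Lemma left_normed_coef0 (f : freeNA F) n : dicommutator_identity f ->
  f@_(left_normed h x n) = 0.
Proof.
move=> /(_ _ _ _ poly_alternative_dialgebra v); rewrite /NAeval => /(congr1 snd).
rewrite (big_morph snd (id1 := 0) (op1 := +%R)) //= => /(congr1 (coefp n)); rewrite /= coef0 coef_sum => E.
rewrite -[RHS]E {1}[f]monalgE raddf_sum /=; apply: eq_bigr => u _.
rewrite mcoeffU coefZ (poly_eval u).2; have sL m : magma_size (left_normed h x m) = m.+1.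
  by elim: m => //= m ->; rewrite addn1.
case: (u =P left_normed h x n) => [->|nu]; first by rewrite sL /= eqxx coefXn eqxx mulr1.
case: eqP => [uE|_]; last by rewrite coef0 mulr0.
by rewrite coefXn; case: eqP => [nE|_]; [rewrite nE in nu|rewrite mulr0].
Qed.
End PolynomialDialgebra.

Section ConstantTails.
Variable F : fieldType.
Hypothesis F2 : (2%:R : F) != 0.
Variables (I : freeNA F -> Prop) (mi : malcev_ideal (@NAmul F) I).
Let sI := mi_sub mi.
Local Notation "f ** g" := (@NAmul F f g) (at level 40, left associativity).

(** Right anticommutativity gives 2a(xx) = 0. A longer product has a factor of size at least 2;
    moved to the right if necessary, it is annihilated by induction. *)
Lemma power_annihilates x u a : all (pred1 x) (leaves u) -> (1 < magma_size u)%N -> I (a ** << u >>).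
Proof.
have ideal b c : I c -> I (b ** c) by case/(mi_ideal mi b).
elim: u a => // u IHu v IHv a; rewrite [leaves _]/= all_cat => /andP[ux vx] _.
have E b : b ** << MMul u v >> = b ** (<< u >> ** << v >>) by rewrite NAmulU.
rewrite E; case: (ltnP 1 (magma_size v)) => [v1|/magma_size1[j vE]]; first exact/ideal/IHv.
have jx : j = x by apply/eqP; move: vx; rewrite vE /= andbT.
have anti := mi_anti mi a << u >> << v >>.
case: (ltnP 1 (magma_size u)) => [u1|/magma_size1[i uE]].
  by rewrite -[X in I X](addrK (a ** (<< v >> ** << u >>))); apply: (subB sI) => //; apply/ideal/IHu.
have ix : i = x by apply/eqP; move: ux; rewrite uE /= andbT.
move: anti; rewrite uE vE jx ix -[X in I X]mulr2n -scaler_nat => /(subZ sI 2%:R^-1).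
by rewrite scalerA mulVf // scale1r.
Qed.

Lemma power_tail x u : all (pred1 x) (behead (leaves u)) ->
  u = left_normed (head_leaf u) x (magma_size u).-1 \/ I << u >>.
Proof.
elim: u => [i|u IHu v _]; first by left.
have -> : behead (leaves (MMul u v)) = behead (leaves u) ++ leaves v.
  by rewrite [leaves (MMul _ _)]/= leaves_head.
rewrite all_cat => /andP[/IHu{}IHu vx].
case: (ltnP 1 (magma_size v)) => [v1|/magma_size1[j vE]].
  by right; rewrite -NAmulU; apply: power_annihilates vx v1.
have jx : j = x by apply/eqP; move: vx; rewrite vE /= andbT.
case: IHu => [uE|Iu]; last by right; rewrite -NAmulU; case: (mi_ideal mi << v >> Iu).
left; rewrite vE jx /= addn1 /= -(prednK (magma_size_gt0 u)) left_normedS.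
by congr MMul.
Qed.

Lemma constant_component (f : freeNA F) h s : dicommutator_identity f -> constant s ->
  I (\sum_(u <- msupp f | has_type h s u) f@_u *: << u >>).
Proof.
move=> f_id /(constantP 0%N)[x sE]; apply: sub_sum => // u _ /andP[_ P].
have ux : all (pred1 x) (behead (leaves u)) by rewrite (perm_all _ P) sE all_pred1_nseq.
have [->|Iu] := power_tail ux; last exact: subZ.
by rewrite left_normed_coef0 // scale0r; apply: sub0.
Qed.
End ConstantTails.

(** * Assembling the components of an identity *)

Lemma pchar_neq0 (F : fieldType) p : prime p -> p \notin [pchar F] -> (p%:R : F) != 0.
Proof. by move=> pr; rewrite inE pr. Qed.

Lemma dicommutator_identity_consequence (F : fieldType) (f : freeNA F) :
  (2%:R : F) != 0 -> (3%:R : F) != 0 -> (NAdeg f <= 6)%N -> dicommutator_identity f ->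
  consequence (@Malcev_dialgebra_identities F) f.
Proof.
(* Monomials are grouped by leftmost variable and multiset of the others; sorting makes the multiset
   a key. Each group lies in [I] on its own. *)
move=> F2 F3 deg f_id I TI Imal; have mi := Tideal_malcev TI Imal; have sI := mi_sub mi.
pose key u := (head_leaf u, sort leq (behead (leaves u))).
have fE : f = \sum_(u <- msupp f) f@_u *: (<< u >> : freeNA F) by rewrite -[LHS]mlift_id.
rewrite fE (big_group _ key); apply: sub_sum => // k; rewrite mem_undup => /mapP[u0 u0f ->] _.
set s := sort leq (behead (leaves u0)).
rewrite (eq_bigl (has_type (head_leaf u0) s)) => [|u]; last first.
  rewrite /key xpair_eqE /has_type; congr (_ && _).
  apply/eqP/idP => [us|/(perm_sortP leq_total leq_trans anti_leq) ->].
    by rewrite -(perm_sort leq) us perm_refl.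
  exact: (sorted_sort leq_trans (sort_sorted leq_total _)).
have s5 : (size s <= 5)%N.
  have: (magma_size u0 <= 6)%N by apply: leq_trans deg; apply: (leq_bigmax_seq u0).
  by rewrite -size_leaves leaves_head /s size_sort.
have [cs|ncs] := boolP (constant s); first exact: constant_component.
exact: mixed_component.
Qed.

Theorem mainTheorem4 (F : fieldType)
    (char_neq2 : 2%N \notin [pchar F]) (char_neq3 : 3%N \notin [pchar F]) :
  (forall f : freeNA F, (NAdeg f <= 6)%N -> dicommutator_identity f ->
     consequence (@Malcev_dialgebra_identities F) f)
  /\ (forall f : freeNA F, special_identity f -> NAdeg f <> 5%N /\ NAdeg f <> 6%N)
  /\ (forall f : freeNA F, special_identity f -> (7 <= NAdeg f)%N).
Proof.
have F2 := pchar_neq0 (isT : prime 2) char_neq2; have F3 := pchar_neq0 (isT : prime 3) char_neq3.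
have low (f : freeNA F) : (NAdeg f <= 6)%N -> dicommutator_identity f ->
    consequence (@Malcev_dialgebra_identities F) f by apply: dicommutator_identity_consequence.
have high (f : freeNA F) : special_identity f -> (7 <= NAdeg f)%N.
  by case=> f_id nf; rewrite ltnNge; apply/negP => f6; exact: (nf (low f f6 f_id)).
by split=> //; split=> // f /high; case: (NAdeg f) => [|[|[|[|[|[|[|]]]]]]].
Qed.
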